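(* Let $(E,\tau)$ be a Fréchet lattice. The following statements are equivalent: (1) $E$ is a band in $E^{\prime\prime}$. (2) Each continuous operator $T:E\rightarrow X$ into an arbitrary Banach space $X$ is generalized $b$-weakly compact. (3) Each positive operator $T:E\rightarrow F$ into an arbitrary Banach lattice $F$ is generalized $b$-weakly compact. (4) Each increasing and topologically bounded sequence $(x_{n})\subset E^{+}$ is convergent. (5) Each increasing and topologically bounded net $(x_{\alpha})\subset E^{+}$ is convergent.
   Context: Conventions: locally convex spaces are real and Hausdorff, Riesz spaces are archimedean, and an operator is a linear map. A locally convex-solid Riesz space is a Riesz space with a locally convex topology generated by Riesz seminorms; a Fréchet lattice is a complete metrizable locally convex-solid Riesz space. $E^{\prime}$ is the topological dual of $E$ with the strong topology $\beta(E^{\prime},E)$, and $E^{\prime\prime}$ is the strong bidual (the topological dual of $(E^{\prime},\beta(E^{\prime},E))$); both are Riesz spaces for the usual dual orderings, and $E$ is regarded as a Riesz subspace of $E^{\prime\prime}$ via the canonical embedding. $E^+$ is the positive cone of $E$. ''Topologically bounded'' means $\tau$-bounded, and convergence in (4), (5) is $\tau$-convergence in $E$. A subset $A\subset E$ is topologically $b$-order bounded if it is order bounded as a subset of $E^{\prime\prime}$. An operator $T:E\to X$ into a Banach space is generalized $b$-weakly compact if it maps topologically $b$-order bounded subsets of $E$ to relatively weakly compact subsets of $X$. *)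

(* Defs.v *)
From HB Require Import structures.
From mathcomp Require Import all_boot all_order all_algebra.
From mathcomp Require Import all_classical all_reals all_analysis.

Set Implicit Arguments.
Unset Strict Implicit.
Unset Printing Implicit Defensive.

Import Order.TTheory GRing.Theory Num.Theory.
Import numFieldNormedType.Exports.

Local Open Scope classical_set_scope.
Local Open Scope ring_scope.

(* Orders are Prop-valued relations rather than instances of [Order.Lattice]:
   Hierarchy Builder rejects a join of [Order.Lattice] (or [Order.POrder]) with
   [CompleteNormedModule] above the existing [Num] hierarchy, and the order of
   the dual spaces below is naturally Prop-valued. *)

Definition is_sup {V : Type} (le : V -> V -> Prop) (A : set V) (s : V) :=
  (forall x, A x -> le x s) /\
  (forall u, (forall x, A x -> le x u) -> le s u).

Definition is_abs {V : zmodType} (le : V -> V -> Prop) (x a : V) :=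
  is_sup le [set x; - x] a.

(* Meant for relations [le] that make [V] a Riesz space, so that the absolute
   values in [is_solid] exist and are unique. *)
Definition is_solid {V : zmodType} (le : V -> V -> Prop) (B : set V) :=
  forall x y ax ay : V, is_abs le x ax -> is_abs le y ay ->
    le ay ax -> B x -> B y.

Definition is_ideal {R : realType} {V : lmodType R} (le : V -> V -> Prop)
    (B : set V) :=
  [/\ B 0, forall (a : R) x y, B x -> B y -> B (a *: x + y) & is_solid le B].

Definition is_band {R : realType} {V : lmodType R} (le : V -> V -> Prop)
    (B : set V) :=
  is_ideal le B /\ (forall A s, A `<=` B -> is_sup le A s -> B s).

HB.mixin Record isRieszSpace (R : realType) E & GRing.Lmodule R E := {
  rle : E -> E -> Prop ;
  rjoin : E -> E -> E ;
  rle_refl : forall x, rle x x ;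
  rle_anti : forall x y, rle x y -> rle y x -> x = y ;
  rle_trans : forall y x z, rle x y -> rle y z -> rle x z ;
  rjoinP : forall x y, is_sup rle [set x; y] (rjoin x y) ;
  rleD2r : forall z x y, rle x y -> rle (x + z) (y + z) ;
  rleZ2l : forall (a : R) x y, 0 <= a -> rle x y -> rle (a *: x) (a *: y) ;
  rle_archimedean : forall x y, rle 0 x ->
    (forall n : nat, rle y (n.+1%:R^-1 *: x)) -> rle y 0
}.

#[short(type="rieszSpaceType")]
HB.structure Definition RieszSpace (R : realType) :=
  {E of GRing.Lmodule R E & isRieszSpace R E}.

#[short(type="rieszTvsType")]
HB.structure Definition RieszTvs (R : realType) :=
  {E of Tvs R E & RieszSpace R E}.

Definition rabs {R : realType} {E : rieszSpaceType R} (x : E) : E :=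
  rjoin x (- x).

Definition riesz_seminorm {R : realType} {E : rieszSpaceType R} (p : E -> R) :=
  [/\ forall x y, p (x + y) <= p x + p y,
      forall (a : R) x, p (a *: x) = `|a| * p x &
      forall x y, rle (rabs x) (rabs y) -> p x <= p y].

Definition generated_by_seminorms {R : realType} {E : tvsType R}
    (P : set (E -> R)) :=
  forall U : set E, nbhs 0 U <->
    exists (n : nat) (p : 'I_n -> E -> R) (e : R),
      [/\ forall i, P (p i), 0 < e & [set x | forall i, p i x < e] `<=` U].

Definition metrizable (R : realType) (T : topologicalType) :=
  exists d : T -> T -> R,
    [/\ forall x y, d x y = 0 <-> x = y,
        forall x y, d x y = d y x,
        forall x y z, d x z <= d x y + d y z &
        forall x (U : set T), nbhs x U <->
          exists2 e : R, 0 < e & [set y | d x y < e] `<=` U].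

(* Completeness for the translation-invariant uniformity of a topological
   vector space. The uniformity carried by a [tvsType] is only required to
   induce the topology, so that [cauchy] would not be the right notion. *)
Definition tvs_complete {R : realType} (E : tvsType R) :=
  forall F : set_system E, ProperFilter F ->
    (forall U : set E, nbhs 0 U ->
      exists2 A, F A & forall x y, A x -> A y -> U (x - y)) ->
    exists l : E, F --> l.

HB.mixin Record isFrechetLattice (R : realType) E
    & RieszTvs R E := {
  locally_convex_solid : exists2 P : set (E -> R),
    P `<=` riesz_seminorm & generated_by_seminorms P ;
  frechet_metrizable : metrizable R E ;
  frechet_complete : tvs_complete E
}.

#[short(type="frechetLatticeType")]
HB.structure Definition FrechetLattice (R : realType) :=
  {E of RieszTvs R E & isFrechetLattice R E}.

HB.mixin Record isBanachLattice (R : realType) F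
    & CompleteNormedModule R F & RieszSpace R F := {
  lattice_norm : forall x y : F, rle (rabs x) (rabs y) -> `|x| <= `|y|
}.

#[short(type="banachLatticeType")]
HB.structure Definition BanachLattice (R : realType) :=
  {F of CompleteNormedModule R F & RieszSpace R F & isBanachLattice R F}.

Definition tvs_bounded {R : realType} {E : preTopologicalLmodType R}
    (A : set E) :=
  forall U : set E, nbhs 0 U ->
    exists2 s : R, 0 < s & forall t : R, s < t -> A `<=` *:%R t @` U.

(* The topological dual, as a subspace of the space of all functions. *)
Section Dual.
Variables (R : realType) (E : preTopologicalLmodType R).

Definition dual_pred : {pred E -> R^o} :=
  fun f => `[< linear f /\ continuous f >].

Lemma dual_pred_submod_closed : submod_closed dual_pred.
Proof.
split=> [|a f g /asboolP[lf cf] /asboolP[lg cg]]; apply/asboolP; split.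
- by move=> a x y; rewrite [LHS]/(0 : R^o) [RHS]addr0 scaler0.
- by move=> x; exact: cvg_cst.
- move=> b x y; rewrite -[LHS]/(a *: f (b *: x + y) + g (b *: x + y)) lf lg.
  by rewrite !scalerDr addrACA (scalerA a b) mulrC -scalerA.
- move=> x; apply: (@cvgD R R^o _ _ _ (fun y => a *: f y) g); last exact: cg.
  by apply: (@cvgZl_tmp R R^o); exact: cf.
Qed.

HB.instance Definition _ :=
  GRing.isSubmodClosed.Build R (E -> R^o) dual_pred dual_pred_submod_closed.

Record dual := Dual { dual_fun :> E -> R^o ; _ : dual_fun \in dual_pred }.

HB.instance Definition _ := [isSub for dual_fun].
HB.instance Definition _ := [Choice of dual by <:].
HB.instance Definition _ := [SubChoice_isSubLmodule of dual by <:].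

(* beta(E', E): uniform convergence on the bounded subsets of E. *)
Definition strong_dual : Type :=
  initial_topology (fun f : dual => (f : {family tvs_bounded, E -> R^o})).

HB.instance Definition _ := GRing.Lmodule.on strong_dual.
HB.instance Definition _ := Topological.on strong_dual.

(* sigma(E, E') *)
Definition weak_space : Type :=
  initial_topology (fun x : E => (fun f : dual => f x) : {ptws dual -> R^o}).

HB.instance Definition _ := Topological.on weak_space.

End Dual.

Definition bidual {R : realType} (E : preTopologicalLmodType R) : Type :=
  dual (strong_dual E).

Section Bidual.
Variables (R : realType) (E : tvsType R).

Lemma eval_in_dual (x : E) :
  (fun f : strong_dual E => (f : dual E) x) \in @dual_pred R (strong_dual E).
Proof.
apply/asboolP; split => // f.
have bx : tvs_bounded [set x].
  move=> U U0.
  have : (fun s : R^o => s *: x) @ (0 : R^o) --> (0 *: x : E).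
    apply: (@continuous_comp _ (R^o * E)%type _ (fun s => (s, x))
      (fun z => z.1 *: z.2)); last exact: scale_continuous.
    by apply: (@cvg_pair _ _ _ _ (nbhs (0 : R^o)));
      [exact: cvg_id|exact: cvg_cst].
  rewrite scale0r => /(_ U U0) /nbhs_ballP[e /= e0 eU].
  exists e^-1 => [|t et _ ->]; first by rewrite invr_gt0.
  have t0 : 0 < t by rewrite (lt_trans _ et)// invr_gt0.
  exists (t^-1 *: x); last by rewrite scalerA divff ?gt_eqF// scale1r.
  apply: eU; rewrite -ball_normE /ball_/= sub0r normrN gtr0_norm ?invr_gt0//.
  by rewrite invf_plt.
have cf := @initial_continuous (dual E) _
  (fun g : dual E => (g : {family tvs_bounded, E -> R^o})) f.
move=> U; rewrite -nbhs_entourageE => -[V eV VU].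
have := cf _ (@fam_nbhs _ _ tvs_bounded _ _ (dual_fun f) eV bx).
apply: (@filterS _ (nbhs (f : strong_dual E))) => g /(_ x erefl) Vg.
by apply: VU; exact/xsectionP.
Qed.

(* The canonical embedding of E into its bidual. *)
Definition eval_bidual (x : E) : bidual E := Dual (eval_in_dual x).

End Bidual.

(* The usual dual orderings of E' and E''. *)
Definition dual_le {R : realType} {E : rieszTvsType R} (f g : dual E) :=
  forall x : E, rle 0 x -> f x <= g x.

Definition bidual_le {R : realType} {E : rieszTvsType R} (u v : bidual E) :=
  forall f : dual E, dual_le 0 f -> u f <= v f.

Definition b_order_bounded {R : realType} {E : rieszTvsType R} (A : set E) :=
  exists u v : bidual E, forall x, A x ->
    bidual_le u (eval_bidual x) /\ bidual_le (eval_bidual x) v.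

Definition relatively_weakly_compact {R : realType} {X : tvsType R}
    (A : set X) :=
  compact (closure (A : set (weak_space X))).

Definition gen_b_weakly_compact {R : realType} {E : rieszTvsType R}
    {X : completeNormedModType R} (T : E -> X) :=
  forall A : set E, b_order_bounded A -> relatively_weakly_compact (T @` A).

Definition directed {I : Type} (le : I -> I -> Prop) :=
  [/\ (exists i : I, True), forall i, le i i,
      forall j i k, le i j -> le j k -> le i k &
      forall i j, exists2 k, le i k & le j k].

(* The filter of the tails of a net indexed by a directed set. *)
Definition tails {I : Type} (le : I -> I -> Prop) : set_system I :=
  filter_from setT (fun i => [set j | le i j]).

(* Main.v *)
Require Import Defs.
From HB Require Import structures.
From mathcomp Require Import all_boot all_order all_algebra.
From mathcomp Require Import all_classical all_reals all_analysis.
From mathcomp Require Import ring lra.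

(* All functionals come from one sandwich form of Hahn-Banach: if [q] is a
   continuous Riesz seminorm and [K] a convex cone in [E * R] such that
   [c <= q (rpos v)] for all [(v, c)] in [K], then some positive [f] in [E']
   with [f <= q \o rpos] satisfies [c <= f v] on [K].

   (1) => (4): the pointwise limit on [E'] of a bounded increasing sequence is
   its supremum in [E''], hence lies in the band [E]; Dini's theorem turns weak
   into topological convergence.  (4) => (5): [E] is complete, and a net that
   is not Cauchy contains a sequence that is not Cauchy.

   (5) => (1): let [x] be the largest element of [E] below a given [y] with
   [0 <= y <= b] and put [z = y - x].  If [z f0 > 0], a Hahn decomposition of
   [z - eps b] gives a positive [f] with [z g >= eps (g b)] for
   [0 <= g <= f], and the smallest [c] in [[0, b]] with [f c = f b] satisfies
   [0 < eps c <= z], because every positive [g] is absolutely continuous with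
   respect to [f] on [[0, c]]; this contradicts the choice of [x].

   (5) => (2): by the previous argument the order intervals of [E] are those
   of [E''], hence weakly compact.  (2) => (3): positive operators are
   continuous.  (3) => (4): apply (3) to the operator [x |-> (f x)_f] into the
   bounded functions on the set of positive [f <= q \o rpos]; the image of an
   increasing sequence has a weak cluster point, to which it converges in norm
   by Dini, and the operator is isometric for [q] on positive elements. *)

Set Implicit Arguments.
Unset Strict Implicit.
Unset Printing Implicit Defensive.

Import Order.TTheory GRing.Theory Num.Theory.
Import numFieldNormedType.Exports.

Local Open Scope classical_set_scope.
Local Open Scope ring_scope.

(** * The Hahn-Banach theorem *)

Section HahnBanach.
Variables (R : realType) (V : lmodType R).
Implicit Types (p : V -> R) (K : V -> R -> Prop).

Definition sublinear p :=
  (forall x y, p (x + y) <= p x + p y) /\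
  (forall (a : R) x, 0 <= a -> p (a *: x) <= a * p x).

Lemma sublinear0 p : sublinear p -> p 0 = 0.
Proof.
move=> [pD pZ]; apply/eqP; rewrite eq_le; apply/andP; split.
  by have := pZ 0 0 (lexx _); rewrite scale0r mul0r.
by have := pD 0 0; rewrite addr0; lra.
Qed.

Lemma sublinearN p x : sublinear p -> - p (- x) <= p x.
Proof.
move=> sp; have [pD _] := sp; have := pD x (- x).
by rewrite subrr sublinear0//; lra.
Qed.

Definition convex_cone K :=
  [/\ K 0 0, forall v c w d, K v c -> K w d -> K (v + w) (c + d) &
      forall (a : R) v c, 0 < a -> K v c -> K (a *: v) (a * c)].

(** A linear [f] below this functional satisfies [f <= p], by [(0, 0)] in [K], and [c <= f v] on
    [K], by taking [x = - v]. All constraints are thus merged into one sublinear bound. *)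
Definition inf_shift p K (x : V) : R :=
  inf [set r | exists v c, K v c /\ r = p (x + v) - c].

Section InfShift.
Variables (p : V -> R) (K : V -> R -> Prop).
Hypotheses (sp : sublinear p) (cK : convex_cone K).
Hypothesis Kp : forall v c, K v c -> c <= p v.

Let lbK x v c : K v c -> - p (- x) <= p (x + v) - c.
Proof.
move=> Kvc; have [pD _] := sp; have := pD (- x) (x + v).
by rewrite addKr; have := Kp Kvc; lra.
Qed.

Lemma inf_shift_le x v c : K v c -> inf_shift p K x <= p (x + v) - c.
Proof.
move=> Kvc; apply: ge_inf; last by exists v, c.
by exists (- p (- x)) => _ [w [d [Kwd ->]]]; exact: lbK.
Qed.

Lemma le_inf_shift x r :
  (forall v c, K v c -> r <= p (x + v) - c) -> r <= inf_shift p K x.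
Proof.
move=> h; apply: lb_le_inf; last by move=> _ [v [c [/h + ->]]].
by have [K0 _ _] := cK; exists (p (x + 0) - 0); exists 0, 0.
Qed.

Lemma inf_shift_sublinear : sublinear (inf_shift p K).
Proof.
have [pD pZ] := sp; have [K0 KD KZ] := cK; split.
  move=> x y; rewrite -lerBlDr; apply: le_inf_shift => v c Kvc.
  rewrite lerBlDl -lerBlDr; apply: le_inf_shift => w d Kwd.
  have := inf_shift_le (x + y) (KD _ _ _ _ Kvc Kwd).
  by have := pD (x + v) (y + w); rewrite addrACA; lra.
move=> a x; rewrite le_eqVlt => /orP[/eqP<-|a0].
  rewrite scale0r mul0r; have := inf_shift_le 0 K0.
  by rewrite addr0 subr0 (sublinear0 sp).
rewrite -ler_pdivrMl//; apply: le_inf_shift => v c Kvc.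
rewrite ler_pdivrMl// mulrBr.
apply: le_trans (inf_shift_le _ (KZ _ _ _ a0 Kvc)) _.
by rewrite -scalerDr lerB// pZ// ltW.
Qed.

End InfShift.

(** As a constraint on a functional [f], this cone prescribes [r <= f x] at the single point [x]. *)
Lemma ray_cone (x : V) (r : R) :
  convex_cone (fun v c => exists2 t : R, 0 <= t & v = t *: x /\ c = t * r).
Proof.
split.
- by exists 0 => //; rewrite scale0r mul0r.
- move=> v c w d [s s0 [-> ->]] [t t0 [-> ->]].
  by exists (s + t); rewrite ?addr_ge0// scalerDl mulrDl.
- move=> a v c a0 [t t0 [-> ->]].
  exists (a * t); last by rewrite scalerA mulrA.
  by rewrite mulr_ge0// ltW.
Qed.

(* A minimal sublinear functional q is linear: otherwise the infimum of
   q (x + t x0) - t q x0 over t >= 0 would be a smaller one. *)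
Lemma sublinear_ge_linear p : sublinear p ->
  exists f : {linear V -> R^o}, forall x, f x <= p x.
Proof.
move=> sp.
pose T := {q : V -> R | sublinear q /\ forall x, q x <= p x}.
(* The order is reversed, so that a maximal element for [le] is a minimal sublinear functional. *)
pose le (q r : T) := `[< forall x, sval r x <= sval q x >].
have [||||q qmin] := @Zorn T le.
- by move=> q; apply/asboolP.
- move=> q r s /asboolP qr /asboolP rs; apply/asboolP => x.
  exact: le_trans (rs x) (qr x).
- move=> q r /asboolP qr /asboolP rq; move: q r qr rq => [q sq] [r sr] /= qr rq.
  apply: eq_exist; apply/funext => x.
  by apply/eqP; rewrite eq_le qr rq.
- move=> A totA; have [[q0 Aq0]|A0] := pselect (exists q, A q); last first.
    have sp' : sublinear p /\ forall x, p x <= p x by [].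
    by exists (exist _ p sp') => s As; case: A0; exists s.
  (* The pointwise infimum of a chain is subadditive because any two of its members are
     comparable. *)
  pose m x := inf [set r | exists2 q, A q & r = sval q x].
  have mle q x : A q -> m x <= sval q x.
    move=> Aq; apply: ge_inf; last by exists q.
    exists (- p (- x)) => _ [r Ar ->].
    have [sr rp] := svalP r; apply: le_trans (sublinearN _ sr).
    by rewrite lerN2.
  have le_m x r : (forall q, A q -> r <= sval q x) -> r <= m x.
    move=> h; apply: lb_le_inf; first by exists (sval q0 x), q0.
    by move=> _ [q Aq ->]; exact: h.
  have sm : sublinear m /\ forall x, m x <= p x.
    split; last first.
      move=> x; have [_ qp] := svalP q0.
      exact: le_trans (mle _ _ Aq0) (qp _).
    split=> [x y|a x a0].
      rewrite -lerBlDr; apply: (@le_m _ _) => q Aq.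
      rewrite lerBlDl -lerBlDr; apply: (@le_m _ _) => r Ar.
      have [[qD _] _] := svalP q; have [[rD _] _] := svalP r.
      have [/asboolP qr|/asboolP rq] := totA _ _ Aq Ar.
        by have := mle _ (x + y) Ar; have := rD x y; have := qr x; lra.
      by have := mle _ (x + y) Aq; have := qD x y; have := rq y; lra.
    move: a0; rewrite le_eqVlt => /orP[/eqP<-|a0].
      have [sq _] := svalP q0; rewrite scale0r mul0r.
      by apply: le_trans (mle _ _ Aq0) _; rewrite sublinear0.
    rewrite -ler_pdivrMl//; apply: (@le_m x) => q Aq; rewrite ler_pdivrMl//.
    have [[_ qZ] _] := svalP q.
    by apply: le_trans (mle _ _ Aq) _; exact/qZ/ltW.
  by exists (exist _ m sm) => q Aq; apply/asboolP => x; exact: mle.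
have [sq qp] := svalP q; have [qD qZ] := sq.
have qN x : sval q (- x) = - sval q x.
  (* By minimality [inf_shift] along this ray is [q] itself; its value at [- x], estimated with
     [v = x], gives [q (- x) <= - q x]. *)
  pose K v c := exists2 t : R, 0 <= t & v = t *: x /\ c = t * sval q x.
  have cK : convex_cone K := ray_cone x (sval q x).
  have Kq v c : K v c -> c <= sval q v.
    move=> [t t0 [-> ->]]; move: t0; rewrite le_eqVlt => /orP[/eqP<-|t0].
      by rewrite scale0r mul0r (sublinear0 sq).
    rewrite -ler_pdivlMl//; have := @qZ t^-1 (t *: x).
    by rewrite scalerA mulVf ?gt_eqF// scale1r invr_ge0; apply; exact: ltW.
  have sP := inf_shift_sublinear sq cK Kq.
  have Pq y : inf_shift (sval q) K y <= sval q y.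
    have [K0 _ _] := cK.
    by apply: le_trans (inf_shift_le sq Kq y K0) _; rewrite addr0 subr0.
  have PP : sublinear (inf_shift (sval q) K) /\
      forall y, inf_shift (sval q) K y <= p y.
    by split=> // y; exact: le_trans (Pq y) (qp y).
  have e : exist _ _ PP = q by apply: qmin; apply/asboolP.
  have K1 : K x (sval q x) by exists 1 => //; rewrite scale1r mul1r.
  have := inf_shift_le sq Kq (- x) K1; rewrite addNr (sublinear0 sq) sub0r => h.
  apply/eqP; rewrite eq_le; apply/andP; split; last first.
    by rewrite lerNl; exact: sublinearN.
  by rewrite -{1}e.
have qDe x y : sval q (x + y) = sval q x + sval q y.
  apply/eqP; rewrite eq_le qD/=.
  by have := qD (- x) (- y); rewrite -opprD !qN; lra.
have qlin : linear (sval q : V -> R^o).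
  have qZp a x : 0 <= a -> sval q (a *: x) = a * sval q x.
    move=> a0; apply/eqP; rewrite eq_le qZ//=.
    by have := qZ a (- x) a0; rewrite scalerN !qN; lra.
  move=> a x y; rewrite qDe; congr (_ + _).
  have [a0|a0] := leP 0 a; first exact: qZp.
  have := qZp (- a) x; rewrite scaleNr qN mulNr => /(_ _)/oppr_inj; apply.
  by rewrite oppr_ge0 ltW.
pose qm := GRing.isLinear.Build _ _ _ _ _ qlin.
pose ql : {linear V -> R^o} := HB.pack (sval q : V -> R^o) qm.
by exists ql => x; exact: qp.
Qed.

Lemma Mazur_Orlicz p K : sublinear p -> convex_cone K ->
  (forall v c, K v c -> c <= p v) ->
  exists f : {linear V -> R^o},
    (forall x, f x <= p x) /\ (forall v c, K v c -> c <= f v).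
Proof.
move=> sp cK Kp; have [K0 _ _] := cK.
have [f fP] := sublinear_ge_linear (inf_shift_sublinear sp cK Kp).
exists f; split=> [x|v c Kvc].
  apply: le_trans (fP x) _.
  by have := inf_shift_le sp Kp x K0; rewrite addr0 subr0.
have := inf_shift_le sp Kp (- v) Kvc; rewrite addNr (sublinear0 sp) sub0r.
by move=> /(le_trans (fP _)); rewrite raddfN lerN2.
Qed.

End HahnBanach.

(** * Riesz spaces *)

Arguments rle_trans {R s y x z}.
Arguments rle_anti {R s x y}.
Arguments rleD2r {R s} z {x y}.
Arguments rleZ2l {R s a x y}.

Section RieszAlgebra.
Variables (R : realType) (E : rieszSpaceType R).
Implicit Types (x y z v b : E) (q : E -> R).

Definition rpos x : E := rjoin x 0.

Lemma rleD x y z v : rle x y -> rle z v -> rle (x + z) (y + v).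
Proof.
move=> xy zv; apply: rle_trans (rleD2r z xy) _.
by rewrite addrC (addrC y); exact: rleD2r.
Qed.

Lemma rsub_ge0 x y : rle x y -> rle 0 (y - x).
Proof. by move=> /(rleD2r (- x)); rewrite subrr. Qed.

Lemma rle_of_sub x y : rle 0 (y - x) -> rle x y.
Proof. by move=> /(rleD2r x); rewrite add0r subrK. Qed.

Lemma rle_opp x y : rle x y -> rle (- y) (- x).
Proof. by move=> /rsub_ge0 h; apply: rle_of_sub; rewrite opprK addrC. Qed.

Lemma rle_subl x y : rle 0 y -> rle (x - y) x.
Proof. by move=> y0; apply: rle_of_sub; rewrite opprB addrC subrK. Qed.

Lemma rle_subrD x y z : rle (x - y) z <-> rle x (z + y).
Proof. by split=> [/(rleD2r y)|/(rleD2r (- y))]; rewrite ?subrK ?addrK. Qed.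

Lemma rleZ_nneg (a : R) x : 0 <= a -> rle 0 x -> rle 0 (a *: x).
Proof. by move=> a0 x0; rewrite -[0](scaler0 _ a); exact: rleZ2l. Qed.

Lemma rle_addr_nneg x y : rle 0 x -> rle 0 y -> rle 0 (x + y).
Proof. by move=> x0 y0; rewrite -[0](addr0 0); exact: rleD. Qed.

Lemma rle_joinl x y : rle x (rjoin x y).
Proof. by have [h _] := rjoinP x y; apply: h; left. Qed.

Lemma rle_joinr x y : rle y (rjoin x y).
Proof. by have [h _] := rjoinP x y; apply: h; right. Qed.

Lemma rjoin_le x y z : rle x z -> rle y z -> rle (rjoin x y) z.
Proof. by move=> xz yz; have [_] := rjoinP x y; apply=> _ [->|->]. Qed.

Lemma rpos_ge0 x : rle 0 (rpos x). Proof. exact: rle_joinr. Qed.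

Lemma rle_rpos x : rle x (rpos x). Proof. exact: rle_joinl. Qed.

Lemma rpos_le x y : rle x y -> rle 0 y -> rle (rpos x) y.
Proof. exact: rjoin_le. Qed.

Lemma rpos_id x : rle 0 x -> rpos x = x.
Proof.
move=> x0; apply: rle_anti; last exact: rle_rpos.
exact: rpos_le (rle_refl x) x0.
Qed.

Lemma rpos_eq0 x : rle x 0 -> rpos x = 0.
Proof.
move=> x0; apply: rle_anti; last exact: rpos_ge0.
exact: rpos_le x0 (rle_refl 0).
Qed.

Lemma rpos_mono x y : rle x y -> rle (rpos x) (rpos y).
Proof.
by move=> xy; apply: rpos_le (rpos_ge0 y); exact: rle_trans xy (rle_rpos y).
Qed.

Lemma rposD x y : rle (rpos (x + y)) (rpos x + rpos y).
Proof.
by apply: rpos_le; [exact: rleD (rle_rpos x) (rle_rpos y)|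
  exact: rle_addr_nneg (rpos_ge0 x) (rpos_ge0 y)].
Qed.

Lemma rposZ (a : R) x : 0 <= a -> rle (rpos (a *: x)) (a *: rpos x).
Proof.
move=> a0; apply: rpos_le; first exact: rleZ2l a0 (rle_rpos x).
exact: rleZ_nneg a0 (rpos_ge0 x).
Qed.

Lemma rjoinE x y : rjoin x y = y + rpos (x - y).
Proof.
apply: rle_anti.
  apply: rjoin_le; first by rewrite addrC; apply/rle_subrD; exact: rle_rpos.
  by rewrite -{1}(addr0 y); exact: rleD (rle_refl y) (rpos_ge0 _).
rewrite -(subrK y (rjoin x y)) [X in rle X _]addrC; apply: rleD2r.
apply: rpos_le; first exact: rleD2r (rle_joinl x y).
exact/rsub_ge0/rle_joinr.
Qed.

Lemma rjoinC x y : rjoin x y = rjoin y x.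
Proof.
by apply: rle_anti; apply: rjoin_le; (exact: rle_joinl || exact: rle_joinr).
Qed.

Lemma rpos_sub x : rpos x - rpos (- x) = x.
Proof.
have := rjoinE 0 (- x); rewrite opprK add0r rjoinC -/(rpos (- x)) => ->.
by rewrite opprD opprK addrCA subrr addr0.
Qed.

(* [v - rpos (v - b)] is the meet of [v] and [b]. *)
Lemma rmeet_lel v b : rle (v - rpos (v - b)) v.
Proof. exact/rle_subl/rpos_ge0. Qed.

Lemma rmeet_ler v b : rle (v - rpos (v - b)) b.
Proof.
by apply/rle_subrD; rewrite addrC; apply/rle_subrD; exact: rle_rpos.
Qed.

Lemma rmeet_ge v b z : rle z v -> rle z b -> rle z (v - rpos (v - b)).
Proof.
move=> zv zb; apply: rle_of_sub; rewrite addrAC; apply/rsub_ge0/rpos_le.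
  exact: rleD (rle_refl v) (rle_opp zb).
exact: rsub_ge0.
Qed.

Lemma rabs_ge x : rle x (rabs x). Proof. exact: rle_joinl. Qed.

Lemma rabs_geN x : rle (- x) (rabs x). Proof. exact: rle_joinr. Qed.

Lemma rabs_ge0 x : rle 0 (rabs x).
Proof.
have := rleD (rabs_ge x) (rabs_geN x); rewrite subrr => h.
have half0 : (0 : R) <= 2^-1 by rewrite invr_ge0.
have := rleZ_nneg half0 h; rewrite -mulr2n -(scaler_nat _ (rabs x)) scalerA.
by rewrite mulVf ?scale1r.
Qed.

Lemma rabs_id x : rle 0 x -> rabs x = x.
Proof.
move=> x0; apply: rle_anti; last exact: rabs_ge.
apply: rjoin_le (rle_refl x) _; have := rle_opp x0; rewrite oppr0 => h.
exact: rle_trans h x0.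
Qed.

Lemma rabsN x : rabs (- x) = rabs x.
Proof. by rewrite /rabs opprK rjoinC. Qed.

Lemma rabsD x y : rle (rabs (x + y)) (rabs x + rabs y).
Proof.
apply: rjoin_le; first exact: rleD (rabs_ge x) (rabs_ge y).
by rewrite opprD; exact: rleD (rabs_geN x) (rabs_geN y).
Qed.

Lemma rabsZ_le (a : R) x : rle (rabs (a *: x)) (`|a| *: rabs x).
Proof.
wlog a0 : a / 0 <= a.
  have [a0|a0] := leP 0 a; first exact.
  move=> /(_ (- a)); rewrite normrN scaleNr rabsN; apply.
  by rewrite oppr_ge0 ltW.
rewrite ger0_norm//; apply: rjoin_le; first exact: rleZ2l a0 (rabs_ge x).
by rewrite -scalerN; exact: rleZ2l a0 (rabs_geN x).
Qed.

Lemma rpos_rabs x : rle (rpos x) (rabs x).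
Proof. exact: rpos_le (rabs_ge x) (rabs_ge0 x). Qed.

Section RieszSeminorm.
Variable q : E -> R.
Hypothesis sq : riesz_seminorm q.

Lemma riesz_seminormN x : q (- x) = q x.
Proof. by have [_ qZ _] := sq; rewrite -scaleN1r qZ normrN1 mul1r. Qed.

Lemma riesz_seminorm0 : q 0 = 0.
Proof. by have [_ qZ _] := sq; rewrite -(scale0r 0) qZ normr0 mul0r. Qed.

Lemma riesz_seminorm_ge0 x : 0 <= q x.
Proof.
have [qD _ _] := sq; have := qD x (- x).
by rewrite subrr riesz_seminorm0 riesz_seminormN; lra.
Qed.

Lemma riesz_seminorm_le x y : rle 0 x -> rle x y -> q x <= q y.
Proof.
move=> x0 xy; have [_ _] := sq; apply; rewrite !rabs_id//.
exact: rle_trans xy.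
Qed.

Lemma riesz_seminorm_abs x : q (rabs x) = q x.
Proof.
have [_ _ qle] := sq; have e := rabs_id (rabs_ge0 x).
by apply/eqP; rewrite eq_le; apply/andP; split; apply: qle; rewrite e;
  exact: rle_refl.
Qed.

Lemma riesz_seminorm_pos x : q (rpos x) <= q x.
Proof.
rewrite -(riesz_seminorm_abs x); apply: riesz_seminorm_le (rpos_ge0 x) _.
exact: rpos_rabs.
Qed.

Lemma riesz_seminormB x y : q (x - y) <= q x + q y.
Proof. by have [qD _ _] := sq; rewrite -(riesz_seminormN y). Qed.

(** A bound by [q (rpos x)] instead of [q x] forces linear functionals to be positive: at [- x] with
    [x >= 0] the bound is [0]. *)
Lemma riesz_seminorm_sublinear : sublinear (fun x => q (rpos x)).
Proof.
have [qD qZ _] := sq; split=> [x y|a x a0].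
  apply: le_trans (qD _ _); apply: riesz_seminorm_le (rpos_ge0 _) _.
  exact: rposD.
rewrite -{2}(ger0_norm a0) -qZ; apply: riesz_seminorm_le (rpos_ge0 _) _.
exact: rposZ.
Qed.

End RieszSeminorm.
End RieszAlgebra.

(** * Positive functionals *)

Section DualAlgebra.
Variables (R : realType) (E : preTopologicalLmodType R).

Lemma dual_linear (f : dual E) : linear (f : E -> R^o).
Proof. by case: f => f /= /asboolP[]. Qed.

HB.instance Definition _ (f : dual E) :=
  GRing.isLinear.Build R E R^o *:%R (dual_fun f) (dual_linear f).

Lemma dual_continuous (f : dual E) : continuous (f : E -> R^o).
Proof. by case: f => f /= /asboolP[]. Qed.

Lemma dual_is_linear (f : E -> R^o) : linear f -> continuous f ->
  exists g : dual E, (g : E -> R^o) = f.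
Proof.
move=> lf cf; have fd : f \in @dual_pred R E by apply/asboolP.
by exists (Dual fd).
Qed.

Lemma dual_ext (f g : dual E) : (forall x, f x = g x) -> f = g.
Proof. by move=> fg; apply: val_inj; apply/funext. Qed.

Lemma dual0E x : (0 : dual E) x = 0 :> R. Proof. by []. Qed.

Lemma dualDE (f g : dual E) x : (f + g) x = f x + g x :> R. Proof. by []. Qed.

Lemma dualNE (f : dual E) x : (- f) x = - f x :> R. Proof. by []. Qed.

Lemma dualBE (f g : dual E) x : (f - g) x = f x - g x :> R. Proof. by []. Qed.

Lemma dualZE (a : R) (f : dual E) x : (a *: f) x = a * f x :> R.
Proof. by []. Qed.

Lemma dual_x0 (f : dual E) : f 0 = 0 :> R. Proof. exact: raddf0. Qed.

Lemma dual_xD (f : dual E) x y : f (x + y) = f x + f y :> R.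
Proof. exact: raddfD. Qed.

Lemma dual_xN (f : dual E) x : f (- x) = - f x :> R.
Proof. exact: raddfN. Qed.

Lemma dual_xB (f : dual E) x y : f (x - y) = f x - f y :> R.
Proof. exact: raddfB. Qed.

Lemma dual_xZ (f : dual E) (a : R) x : f (a *: x) = a * f x :> R.
Proof. exact: linearZ. Qed.

End DualAlgebra.

Section ContinuousSeminorm.
Variables (R : realType) (E : rieszTvsType R).

Definition continuous_riesz_seminorm (q : E -> R) :=
  riesz_seminorm q /\ forall e, 0 < e -> nbhs 0 [set x | q x < e].

Lemma nbhs0_translate (x : E) (U : set E) :
  nbhs 0 U -> nbhs x [set y | U (y - x)].
Proof.
move=> /(nbhsT x); apply: filterS => _ [z Uz <-] /=.
by rewrite addrC addKr.
Qed.

Lemma nbhs_translate0 (x : E) (U : set E) :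
  nbhs x U -> nbhs 0 [set y | U (x - y)].
Proof.
move=> xU; have := @nbhsB R E U x (- x) xU; rewrite addNr => /nbhs0N.
by apply: filterS => _ [_ [z Uz <-] <-] /=; rewrite opprD opprK subKr.
Qed.

Lemma dominated_continuous (q : E -> R) (f : {linear E -> R^o}) :
  continuous_riesz_seminorm q -> (forall x, f x <= q (rpos x)) ->
  continuous f.
Proof.
move=> [sq cq] fq x; apply/cvgrPdist_lt => e e0.
have fle z : `|f z : R| <= q z.
  rewrite ler_norml; apply/andP; split.
    rewrite lerNl -raddfN; apply: le_trans (fq _) _.
    by rewrite -(riesz_seminormN sq z); exact: riesz_seminorm_pos.
  exact: le_trans (fq z) (riesz_seminorm_pos sq z).
apply: filterS (nbhs0_translate x (cq e e0)) => y /= qe.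
rewrite distrC -raddfB; exact: le_lt_trans (fle _) qe.
Qed.

Lemma dual_sandwich (q : E -> R) (K : E -> R -> Prop) :
  continuous_riesz_seminorm q -> convex_cone K ->
  (forall v c, K v c -> c <= q (rpos v)) ->
  exists f : dual E, [/\ dual_le 0 f, forall x, f x <= q (rpos x) &
    forall v c, K v c -> c <= f v].
Proof.
move=> cq cK Kq; have [sq _] := cq.
have [f [fq Kf]] := Mazur_Orlicz (riesz_seminorm_sublinear sq) cK Kq.
have [g gE] := dual_is_linear (linearP f) (dominated_continuous cq fq).
exists g; rewrite gE; split=> // x x0; rewrite gE dual0E.
have := fq (- x); rewrite rpos_eq0 ?riesz_seminorm0// ?raddfN ?oppr_le0//.
by have := rle_opp x0; rewrite oppr0.
Qed.

End ContinuousSeminorm.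

Local Notation csn := continuous_riesz_seminorm.

Section PositiveFunctionals.
Variables (R : realType) (E : rieszTvsType R).
Implicit Types (f g h : dual E) (q : E -> R).

(** The sandwich theorem for the ray through [(x, q (rpos x))]. For [x >= 0] the functional attains
    [q x]. *)
Lemma dual_norming q (x : E) : continuous_riesz_seminorm q ->
  exists f, [/\ dual_le 0 f, forall y, f y <= q (rpos y) & f x = q (rpos x)].
Proof.
move=> cq; have [sq _] := cq; have [qD qZ _] := sq.
have [|f [f0 fq fK]] := dual_sandwich cq (ray_cone x (q (rpos x))).
  move=> v c [t t0 [-> ->]]; move: t0; rewrite le_eqVlt => /orP[/eqP<-|t0].
    by rewrite mul0r; exact: riesz_seminorm_ge0.
  have [_ qpZ] := riesz_seminorm_sublinear sq.
  have ti0 : 0 <= t^-1 by rewrite invr_ge0 ltW.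
  have := qpZ _ (t *: x) ti0; rewrite scalerA mulVf ?gt_eqF// scale1r.
  by rewrite ler_pdivlMl.
exists f; split=> //; apply/eqP; rewrite eq_le fq/=; apply: fK.
by exists 1 => //; rewrite scale1r mul1r.
Qed.

Lemma dual_le_norm q f : riesz_seminorm q ->
  (forall x, f x <= q (rpos x)) -> forall x, `|f x : R| <= q x.
Proof.
move=> sq fq z; rewrite ler_norml; apply/andP; split.
  rewrite lerNl -dual_xN; apply: le_trans (fq _) _.
  by rewrite -(riesz_seminormN sq z); exact: riesz_seminorm_pos.
exact: le_trans (fq z) (riesz_seminorm_pos sq z).
Qed.

Lemma dual_homo f x y : dual_le 0 f -> rle x y -> f x <= f y.
Proof. by move=> f0 /rsub_ge0 /f0; rewrite dual0E dual_xB subr_ge0. Qed.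

Lemma dual_le_refl f : dual_le f f. Proof. by []. Qed.

Lemma dual_le_trans g f h : dual_le f g -> dual_le g h -> dual_le f h.
Proof. by move=> fg gh x x0; apply: le_trans (fg x x0) (gh x x0). Qed.

Lemma dual_le_anti f g : dual_le f g -> dual_le g f -> f = g.
Proof.
move=> fg gf; apply: dual_ext => x.
have e (y : E) : rle 0 y -> f y = g y.
  by move=> y0; apply/eqP; rewrite eq_le fg//= gf.
by rewrite -(rpos_sub x) !dual_xB !e//; exact: rpos_ge0.
Qed.

Lemma dual_sub_ge0 f g : dual_le f g -> dual_le 0 (g - f).
Proof. by move=> fg x x0; rewrite dualBE dual0E subr_ge0; exact: fg. Qed.

(* Contrapositive of Dini's theorem. *)
Lemma dual_below_decreasing q (u : nat -> E) (d : R) :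
  continuous_riesz_seminorm q -> 0 < d ->
  (forall n, rle 0 (u n)) -> (forall m n, (m <= n)%N -> rle (u n) (u m)) ->
  (forall n, d <= q (u n)) ->
  exists f, dual_le 0 f /\ forall n, d <= f (u n).
Proof.
move=> cq d0 u0 udec uq; have [sq _] := cq; have [qD qZ _] := sq.
(* Since [u] decreases, [s u_m + t u_n] dominates [(s + t) u_k] with [k] the larger index; this
   makes the upward closed set [K] stable under addition. *)
pose K v c := exists n, exists2 t : R, 0 <= t & rle (t *: u n) v /\ c = t * d.
have cK : convex_cone K.
  split.
  - by exists 0%N, 0 => //; rewrite scale0r mul0r; split=> //; exact: rle_refl.
  - move=> v c w e [m [s s0 [sv ->]]] [n [t t0 [tw ->]]].
    exists (maxn m n), (s + t); first by rewrite addr_ge0.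
    split; last by rewrite mulrDl.
    rewrite scalerDl; apply: rleD.
      by apply: rle_trans sv; apply: rleZ2l => //; apply/udec/leq_maxl.
    by apply: rle_trans tw; apply: rleZ2l => //; apply/udec/leq_maxr.
  - move=> a v c a0 [n [t t0 [tv ->]]]; exists n, (a * t).
      by rewrite mulr_ge0// ltW.
    by rewrite mulrA -scalerA; split=> //; apply: rleZ2l => //; exact: ltW.
have [|f [f0 _ fK]] := dual_sandwich cq cK; last first.
  exists f; split=> // n; apply: fK; exists n, 1 => //.
  by rewrite scale1r mul1r; split=> //; exact: rle_refl.
move=> v c [n [t t0 [tv ->]]]; apply: (@le_trans _ _ (q (t *: u n))).
  by rewrite qZ ger0_norm// ler_wpM2l.
apply: riesz_seminorm_le => //; first exact: rleZ_nneg.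
exact: rle_trans tv (rle_rpos v).
Qed.

(** Upper bounds of chains, as Zorn's lemma needs them, with control of the value at [b]. The cone
    encodes [f v <= h v] for [v >= 0] together with [h b <= S]. It is dominated by [q \o rpos]
    because [v] splits into its meet with [t b], where [f] is at most [t S], and [rpos (v - t b)],
    where [f] is at most [q]. *)
Lemma dual_chain_sup q (A : set (dual E)) (b : E) (S : R) :
  continuous_riesz_seminorm q -> A !=set0 ->
  (forall f g, A f -> A g -> dual_le f g \/ dual_le g f) ->
  (forall f v, A f -> rle 0 v -> f v <= q v) -> rle 0 b ->
  (forall f v, A f -> rle 0 v -> rle v b -> f v <= S) ->
  exists h, [/\ dual_le 0 h, forall x, h x <= q (rpos x),
    forall f, A f -> dual_le f h & h b <= S].
Proof.
move=> cq [f0 Af0] totA Aq b0 AS; have [sq _] := cq; have [qD qZ _] := sq.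
pose K w c := exists f v, exists2 t : R, 0 <= t &
  [/\ A f, rle 0 v, w = v - t *: b & c <= f v - t * S].
have cK : convex_cone K.
  split.
  - exists f0, 0, 0 => //; split => //; first exact: rle_refl.
      by rewrite scale0r subr0.
    by rewrite mul0r subr0 dual_x0.
  - move=> w1 c1 w2 c2 [f [v [s s0 [Af v0 -> cf]]]].
    move=> [g [w [t t0 [Ag w0 -> cg]]]].
    have mx : exists2 h, A h & dual_le f h /\ dual_le g h.
      have [fg|gf] := totA _ _ Af Ag; [exists g|exists f] => //; split=> //;
        exact: dual_le_refl.
    have [h Ah [fh gh]] := mx.
    exists h, (v + w), (s + t); first by rewrite addr_ge0.
    split => //; first exact: rle_addr_nneg.
      by rewrite scalerDl opprD addrACA.
    by rewrite mulrDl dual_xD; have := fh _ v0; have := gh _ w0; lra.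
  - move=> a w c a0 [f [v [t t0 [Af v0 -> cf]]]].
    exists f, (a *: v), (a * t); first by rewrite mulr_ge0// ltW.
    split => //; first by apply: rleZ_nneg => //; exact: ltW.
      by rewrite scalerBr scalerA.
    by rewrite dual_xZ -mulrA -mulrBr ler_pM2l.
have [|h [h0 hq hK]] := dual_sandwich cq cK; last first.
  exists h; split=> // [f Af x x0|].
    apply: hK; exists f, x, 0 => //; split=> //; first by rewrite scale0r subr0.
    by rewrite mul0r subr0.
  rewrite -[leRHS]opprK -[leLHS]opprK lerN2 -dual_xN; apply: hK.
  exists f0, 0, 1 => //; split => //; first exact: rle_refl.
    by rewrite scale1r sub0r.
  by rewrite dual_x0 mul1r sub0r.
move=> w c [f [v [t t0 [Af v0 -> ]]]] /le_trans; apply.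
set m := v - rpos (v - t *: b).
have m0 : rle 0 m by apply: rmeet_ge => //; exact: rleZ_nneg.
have mb : rle m (t *: b) by exact: rmeet_ler.
have fm : f m <= t * S.
  move: t0; rewrite le_eqVlt => /orP[/eqP t0|t0].
    move: mb; rewrite -t0 scale0r mul0r => m0'.
    by rewrite (rle_anti m0' m0) dual_x0.
  rewrite -ler_pdivrMl// -dual_xZ; apply: AS => //.
    by apply: rleZ_nneg => //; rewrite invr_ge0 ltW.
  have ti0 : 0 <= t^-1 by rewrite invr_ge0 ltW.
  by have := rleZ2l ti0 mb; rewrite scalerA mulVf ?gt_eqF// scale1r.
have -> : f v = f m + f (rpos (v - t *: b)) :> R by rewrite -dual_xD subrK.
by have := Aq f _ Af (rpos_ge0 (v - t *: b)); lra.
Qed.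

Section LocallySolid.
Hypothesis lcs : forall U : set E, nbhs 0 U ->
  exists2 q, continuous_riesz_seminorm q & [set x | q x < 1] `<=` U.

Lemma dual_dominated f :
  exists2 q, continuous_riesz_seminorm q & forall x, `|f x : R| <= q x.
Proof.
have := @dual_continuous _ _ f 0; rewrite /continuous_at dual_x0 => cf0.
have U0 : nbhs (0 : E) [set x | `|f x : R| < 1].
  move/cvgrPdist_lt : cf0 => /(_ 1 ltr01); apply: filterS => x /=.
  by rewrite sub0r normrN.
have [q cq qU] := lcs U0; exists q => // x.
have [sq _] := cq; have [_ qZ _] := sq.
apply/ler_addgt0Pr => e e0; have qx := riesz_seminorm_ge0 sq x.
(* [q x] may vanish, so [x] is scaled by the inverse of [q x + e]. *)
have qe : 0 < q x + e by rewrite ltr_wpDl.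
have /= := qU ((q x + e)^-1 *: x).
rewrite qZ dual_xZ normrM gtr0_norm ?invr_gt0// ltr_pdivrMl// mulr1.
by rewrite ltrDl ltr_pdivrMl// mulr1 => /(_ e0)/ltW.
Qed.

(** With this seminorm as the bound in the sandwich theorem, the functionals obtained lie between
    [0] and [f]. *)
Lemma dual_abs_seminorm f : dual_le 0 f ->
  continuous_riesz_seminorm (fun x => f (rabs x)).
Proof.
move=> f0; have [q cq fq] := dual_dominated f; have [sq q_cont] := cq.
split; last first.
  move=> e e0; apply: filterS (q_cont e e0) => x /= /(le_lt_trans _); apply.
  rewrite -(riesz_seminorm_abs sq); apply: le_trans (fq _).
  exact: ler_norm.
have fZ (a : R) (x : E) : f (rabs (a *: x)) <= `|a| * f (rabs x).
  by rewrite -dual_xZ; apply: dual_homo => //; exact: rabsZ_le.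
split=> [x y|a x|x y xy]; last exact: dual_homo.
- by rewrite -dual_xD; apply: dual_homo => //; exact: rabsD.
- apply/eqP; rewrite eq_le fZ/=; have [->|a0] := eqVneq a 0.
    by rewrite normr0 mul0r; apply: f0; exact: rabs_ge0.
  have := fZ a^-1 (a *: x); rewrite scalerA mulVf// scale1r normfV.
  by rewrite ler_pdivlMl ?normr_gt0.
Qed.

(** The one-element chain [f], with [b = 0] and [S = 0], has a positive upper bound [h], and
    [f = h - (h - f)]. *)
Lemma dual_pos_decomposition f :
  exists g h, [/\ dual_le 0 g, dual_le 0 h & f = g - h].
Proof.
have [q cq fq] := dual_dominated f.
have [|||_ v -> v0 v0'|h [h0 _ fh _]] :=
    @dual_chain_sup q [set f] 0 0 cq _ _ _ (rle_refl 0) _.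
- by exists f.
- by move=> _ _ -> ->; left.
- by move=> _ v -> _; apply: le_trans (fq v); exact: ler_norm.
- by rewrite (rle_anti v0' v0) dual_x0.
by exists h, (h - f); split; [|exact/dual_sub_ge0/fh|rewrite subKr].
Qed.

(** Norming [x - y] for the seminorm of [f] gives [0 <= g <= f] with [g (x - y) = f (rpos (x - y))];
    then [h = f - g] works because [rjoin x y = y + rpos (x - y)]. *)
Lemma dual_join_split f (x y : E) : dual_le 0 f ->
  exists g h, [/\ dual_le 0 g, dual_le 0 h, f = g + h &
    f (rjoin x y) = g x + h y :> R].
Proof.
move=> f0; have [g [g0 gq gx]] := dual_norming (x - y) (dual_abs_seminorm f0).
exists g, (f - g); split=> //; [|by rewrite addrC subrK|].
  apply: dual_sub_ge0 => z z0; apply: le_trans (gq z) _.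
  by rewrite rpos_id// rabs_id.
rewrite rjoinE dual_xD dualBE.
by move: gx; rewrite dual_xB rabs_id; [lra|exact: rpos_ge0].
Qed.

End LocallySolid.
End PositiveFunctionals.

(** * The strong bidual *)

Lemma cvg_initial (S : choiceType) (T : topologicalType) (f : S -> T)
    (F : set_system S) (s : S) : Filter F ->
  f @ F --> f s -> F --> (s : initial_topology f).
Proof.
move=> FF Ffs A /= [_ [[B Bop <-] Bfs sBfA]].
apply: filterS sBfA _; apply: Ffs.
by rewrite nbhsE; exists B.
Qed.

Section BoundedSets.
Variables (R : realType) (E : preTopologicalLmodType R).

Lemma tvs_boundedU (A B : set E) :
  tvs_bounded A -> tvs_bounded B -> tvs_bounded (A `|` B).
Proof.
move=> bA bB U U0; have [a a0 aA] := bA U U0; have [b b0 bB'] := bB U U0.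
exists (Num.max a b) => [|t]; first by rewrite lt_max a0.
rewrite gt_max => /andP[at_ bt]; rewrite subUset.
by split; [exact: aA|exact: bB'].
Qed.

Lemma tvs_bounded0 : tvs_bounded (set0 : set E).
Proof. by move=> U _; exists 1 => // t _ x. Qed.

End BoundedSets.

Section Bidual.
Variables (R : realType) (E : preTopologicalLmodType R).

Let small (i : set E * R) : set (dual E) :=
  [set f | forall x, i.1 x -> `|f x : R| < i.2].

Let base : set_system (dual E) :=
  filter_from [set i : set E * R | tvs_bounded i.1 /\ 0 < i.2] small.

Let base_filter : Filter base.
Proof.
apply: filter_from_filter.
  by exists (set0, 1); split=> //=; exact: tvs_bounded0.
move=> [A a] [B b] [/= bA a0] [/= bB b0].
exists (A `|` B, Num.min a b).
  by split=> /=; [exact: tvs_boundedU|rewrite lt_min a0].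
move=> f fAB; split=> x /= Ax.
  by have := fAB x (or_introl Ax); rewrite lt_min => /andP[].
by have := fAB x (or_intror Ax); rewrite lt_min => /andP[].
Qed.

(** Continuity of [w] at [0] for uniform convergence on bounded sets: [w] stays below [1] on the
    functionals that are smaller than some [d] on some bounded [M]. The rest is scaling. *)
Lemma bidual_bounded (w : dual (strong_dual E)) :
  exists (M : set E) (C : R), [/\ tvs_bounded M, 0 <= C &
    forall (f : dual E) e, 0 < e -> (forall x, M x -> `|f x : R| <= e) ->
      `|w f : R| <= C * e].
Proof.
have FF := base_filter.
have base0 : base --> (0 : strong_dual E).
  apply: (@cvg_initial _ _ (fun f : dual E =>
    (f : {family tvs_bounded, E -> R^o}))).
  suff : {family tvs_bounded, (fun f : dual E => (f : E -> R^o)) @ base -->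
      ((0 : dual E) : E -> R^o)} by [].
  apply/fam_cvgP => A bA P /uniform_nbhs[V [+ VP]].
  rewrite -entourage_ballE => -[e /= e0 eV].
  exists (A, e) => // f /= fA; apply: VP => x Ax; apply: eV => /=.
  by rewrite -ball_normE /= sub0r normrN; exact: fA.
have := @dual_continuous _ _ w 0; rewrite /continuous_at dual_x0.
move=> /cvgrPdist_lt/(_ 1 ltr01)/base0[[M d] [/= bM d0] Mw].
(* The factor [2] turns the bound [<= e] on [M] into the strict bound [< d] after scaling. *)
exists M, (2 / d); split=> //; first by rewrite divr_ge0// ltW.
move=> f e e0 fM; have := Mw ((d / (2 * e)) *: f : dual E).
have c0 : 0 < d / (2 * e) by rewrite divr_gt0// mulr_gt0.
rewrite sub0r normrN dual_xZ normrM gtr0_norm//.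
rewrite -ltr_pdivlMl// invf_div mulr1.
move=> /(_ _)/ltW; rewrite mulrAC; apply => x Mx.
rewrite dualZE normrM gtr0_norm// -ltr_pdivlMl// invf_div.
by apply: le_lt_trans (fM x Mx) _; rewrite divfK ?gt_eqF//; lra.
Qed.

(** The source of elements of the bidual: pointwise limits of evaluations at points of [M] satisfy
    this bound, which makes [phi] Lipschitz for uniform convergence on [M]. *)
Lemma bidual_intro (phi : dual E -> R^o) (M : set E) :
  linear phi -> tvs_bounded M ->
  (forall (f : dual E) e, (forall x, M x -> `|f x : R| <= e) ->
    `|phi f : R| <= e) ->
  exists w : dual (strong_dual E), forall f : dual E, w f = phi f.
Proof.
move=> lphi bM phiM.
have [|w we] := @dual_is_linear R (strong_dual E) phi lphi; last first.
  by exists w => f; rewrite we.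
move=> f; have FF : Filter (nbhs (f : strong_dual E)) := nbhs_filter _.
apply/(@cvgrPdist_le _ _ _ (nbhs (f : strong_dual E)) FF) => e e0.
have cf := @initial_continuous (dual E) _
  (fun g : dual E => (g : {family tvs_bounded, E -> R^o})) f.
have Nf := cf _ (@fam_nbhs _ _ tvs_bounded _ _ (dual_fun f)
  (entourage_ball _ (PosNum e0)) bM).
refine (@filterS _ _ FF _ _ _ Nf) => g /= fg.
have -> : phi f - phi g = phi (f - g).
  have := lphi (-1) g f; rewrite !scaleN1r => h.
  by rewrite [LHS]addrC -h; congr phi; rewrite addrC.
apply: phiM => x Mx; have := fg x Mx.
by rewrite /= -ball_normE /= => /ltW.
Qed.

End Bidual.

(** * Frechet lattices *)

Section FrechetTopology.
Variables (R : realType) (E : frechetLatticeType R).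
Implicit Types (q : E -> R).

Lemma frechet_lcs (U : set E) : nbhs 0 U ->
  exists2 q, csn q & [set x | q x < 1] `<=` U.
Proof.
have [P Ps Pgen] := @locally_convex_solid R E.
move=> /Pgen[n [p [e [Pp e0 pU]]]].
have ps i : riesz_seminorm (p i) by exact: Ps.
exists (fun x => e^-1 * \sum_(i < n) p i x); last first.
  move=> x /=; rewrite ltr_pdivrMl// mulr1 => px; apply: pU => i /=.
  apply: le_lt_trans px; rewrite (bigD1 i)//= lerDl sumr_ge0// => j _.
  exact: riesz_seminorm_ge0.
have ei0 : 0 < e^-1 by rewrite invr_gt0.
split; first split.
- move=> x y; rewrite -mulrDr ler_pM2l// -big_split/=; apply: ler_sum => i _.
  by have [pD _ _] := ps i.
- move=> a x; rewrite mulrCA; congr (_ * _); rewrite mulr_sumr.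
  by apply: eq_bigr => i _; have [_ pZ _] := ps i.
- move=> x y xy; rewrite ler_pM2l//; apply: ler_sum => i _.
  by have [_ _ ple] := ps i; exact: ple.
(* Dividing by [n.+1] covers [n = 0] and keeps the sum of the [n] bounds strictly below [d * e]. *)
move=> d d0; apply/Pgen; exists n, p, (d * e / n.+1%:R); split=> //.
  by rewrite divr_gt0// mulr_gt0.
move=> x /= px; rewrite ltr_pdivrMl//.
apply: (@le_lt_trans _ _ (\sum_(i < n) (d * e / n.+1%:R))).
  by apply: ler_sum => i _; exact/ltW.
rewrite sumr_const card_ord -[_ *+ n]mulr_natr mulrAC ltr_pdivrMr ?ltr0n//.
by rewrite (mulrC d e) ltr_pM2l ?mulr_gt0// ltr_nat.
Qed.

(** Metrizability enters here as separation of points: a ball around [0] that misses [x] contains a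
    seminorm ball. *)
Lemma csn_eq0 (x : E) : (forall q, csn q -> q x = 0) -> x = 0.
Proof.
move=> qx; have [d [d0 dC dD dN]] := @frechet_metrizable R E.
have dge a b : 0 <= d a b.
  by have := dD a b a; rewrite (d0 a a).2// (dC b a); lra.
apply/esym/d0/eqP; apply: contrapT => /negP dx.
have U0 : nbhs (0 : E) [set y | d 0 y < d 0 x].
  by apply/dN; exists (d 0 x); rewrite // lt_neqAle eq_sym dx dge.
have [q cq /(_ x)/=] := frechet_lcs U0.
by rewrite qx// ltr01 ltxx => /(_ isT).
Qed.

Lemma csn_pos_le (x y : E) :
  (forall q, csn q -> q (rpos (x - y)) <= 0) -> rle x y.
Proof.
move=> h; have e : rpos (x - y) = 0.
  apply: csn_eq0 => q cq; have [sq _] := cq.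
  by apply/eqP; rewrite eq_le h//= riesz_seminorm_ge0.
have := rle_rpos (x - y); rewrite e => /(rleD2r y).
by rewrite subrK add0r.
Qed.

Lemma frechet_base : exists q : nat -> E -> R, (forall n, csn (q n)) /\
  forall U : set E, nbhs 0 U -> exists n, [set x | q n x < 1] `<=` U.
Proof.
have [d [d0 dC dD dN]] := @frechet_metrizable R E.
have V n : nbhs (0 : E) [set y | d 0 y < n.+1%:R^-1].
  by apply/dN; exists n.+1%:R^-1.
have /choice[q qP] n : exists q,
    csn q /\ [set x | q x < 1] `<=` [set y | d 0 y < n.+1%:R^-1].
  by have [q] := frechet_lcs (V n); exists q.
exists q; split=> [n|U /dN[e e0 eU]]; first by have [] := qP n.
have [n ne] : exists n : nat, n.+1%:R^-1 < e.
  exists (Num.bound e^-1); rewrite invf_plt ?posrE//.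
  have := archi_boundP (ltW (_ : 0 < e^-1)); rewrite invr_gt0 => /(_ e0) h.
  by apply: lt_trans h _; rewrite ltr_nat.
exists n; apply: subset_trans (qP n).2 _; apply: subset_trans eU => y /=.
by move=> /lt_trans; exact.
Qed.

Lemma tvs_bounded_csn (A : set E) q : tvs_bounded A -> csn q ->
  exists2 C : R, 0 <= C & forall x, A x -> q x <= C.
Proof.
move=> bA [[qD qZ qle] cq]; have [s s0 sA] := bA _ (cq 1 ltr01).
exists (s + 1) => [|x Ax]; first by rewrite addr_ge0// ltW.
have [|y /= qy <-] := sA (s + 1) _ x Ax; first by rewrite ltrDl.
rewrite qZ ger0_norm ?addr_ge0 ?(ltW s0)//.
by rewrite ger_pMr ?ltW// addr_gt0.
Qed.

Lemma csn_tvs_bounded (A : set E) :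
  (forall q, csn q -> exists C, forall x, A x -> q x <= C) -> tvs_bounded A.
Proof.
move=> qA U /frechet_lcs[q cq qU]; have [C AC] := qA q cq.
have [[qD qZ _] _] := cq.
exists (`|C| + 1) => [|t Ct x Ax]; first by rewrite ltr_wpDl.
have t0 : 0 < t by apply: lt_trans Ct; rewrite ltr_wpDl.
exists (t^-1 *: x); last by rewrite scalerA divff ?gt_eqF// scale1r.
apply: qU => /=; rewrite qZ gtr0_norm ?invr_gt0// ltr_pdivrMl// mulr1.
apply: le_lt_trans (AC x Ax) _; apply: le_lt_trans Ct.
by rewrite (le_trans (ler_norm _))// lerDl.
Qed.

Section Convergence.
Variables (T : Type) (F : set_system T).

Lemma cvg_csn {FF : Filter F} (x : T -> E) (l : E) :
  (forall q e, csn q -> 0 < e -> F [set i | q (l - x i) < e]) ->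
  x @ F --> l.
Proof.
move=> h U /nbhs_translate0/frechet_lcs[q cq qU].
apply: (@filterS _ F _ _ _ _ (h q 1 cq ltr01)) => i qi.
by have := qU _ qi; rewrite /= opprB addrC subrK.
Qed.

Lemma csn_cvg {FF : Filter F} (x : T -> E) (l : E) q e : csn q -> 0 < e ->
  x @ F --> l -> F [set i | q (l - x i) < e].
Proof.
move=> [sq cq] e0 xl; have h := xl _ (nbhs0_translate l (cq e e0)).
by apply: (@filterS _ F _ _ _ _ h) => i /=; rewrite -(riesz_seminormN sq) opprB.
Qed.

Lemma cvg_rle_lower {FF : ProperFilter F} (x : T -> E) (l y : E) :
  x @ F --> l -> F [set i | rle y (x i)] -> rle y l.
Proof.
move=> xl yx; apply: csn_pos_le => q cq; have [sq _] := cq.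
apply/ler_addgt0Pr => e e0; rewrite add0r.
have [i [/= yi le]] := filter_ex (filterI yx (csn_cvg cq e0 xl)).
apply: le_trans (ltW le); rewrite -(riesz_seminormN sq (l - _)) opprB.
apply: le_trans (riesz_seminorm_pos sq _).
by apply: riesz_seminorm_le (rpos_ge0 _) _ => //; exact/rpos_mono/rleD2r.
Qed.

Lemma cvg_rle_upper {FF : ProperFilter F} (x : T -> E) (l y : E) :
  x @ F --> l -> F [set i | rle (x i) y] -> rle l y.
Proof.
move=> xl xy; apply: csn_pos_le => q cq; have [sq _] := cq.
apply/ler_addgt0Pr => e e0; rewrite add0r.
have [i [/= iy le]] := filter_ex (filterI xy (csn_cvg cq e0 xl)).
apply: le_trans (ltW le).
apply: le_trans (riesz_seminorm_pos sq _).
apply: riesz_seminorm_le (rpos_ge0 _) _ => //; apply: rpos_mono.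
exact: rleD (rle_refl l) (rle_opp iy).
Qed.

Lemma cauchy_csn {FF : ProperFilter F} (x : T -> E) :
  (forall q e, csn q -> 0 < e ->
     exists2 A, F A & forall i j, A i -> A j -> q (x i - x j) < e) ->
  exists l : E, x @ F --> l.
Proof.
move=> h; apply: (@frechet_complete R E (x @ F)) => U /frechet_lcs[q cq qU].
have [A FA Aq] := h q 1 cq ltr01.
exists (x @` A); last by move=> _ _ [i Ai <-] [j Aj <-]; apply/qU/Aq.
by apply: (@filterS _ F _ _ _ _ FA) => i Ai; exists i.
Qed.

End Convergence.

Lemma dual_sep (x y : E) :
  (forall f : dual E, dual_le 0 f -> f x <= f y) -> rle x y.
Proof.
move=> h; apply: csn_pos_le => q cq.
have [f [f0 _ <-]] := dual_norming (x - y) cq.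
by rewrite dual_xB subr_le0; exact: h.
Qed.

Lemma eval_bidualE (x : E) (f : dual E) : eval_bidual x f = f x.
Proof. by []. Qed.

Lemma eval_bidual_le (x y : E) :
  rle x y -> bidual_le (eval_bidual x) (eval_bidual y).
Proof. by move=> xy f f0; rewrite !eval_bidualE; exact: dual_homo. Qed.

Lemma bidual_le_eval (x y : E) :
  bidual_le (eval_bidual x) (eval_bidual y) -> rle x y.
Proof. by move=> xy; apply: dual_sep. Qed.

Lemma bidual_le_anti (u v : bidual E) : bidual_le u v -> bidual_le v u -> u = v.
Proof.
move=> uv vu; apply: dual_ext => f.
have [g [h [g0 h0 ->]]] := dual_pos_decomposition frechet_lcs f.
have e k : dual_le 0 k -> u k = v k :> R.
  by move=> k0; apply/eqP; rewrite eq_le uv//= vu.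
by rewrite !dual_xB !e.
Qed.

(** Splitting [f] reduces the claim to [x] and [y] separately. Hence the elements of [E] below [s]
    are directed upwards. *)
Lemma bidual_join_le (x y : E) (s : bidual E) :
  bidual_le (eval_bidual x) s -> bidual_le (eval_bidual y) s ->
  bidual_le (eval_bidual (rjoin x y)) s.
Proof.
move=> xs ys f f0; rewrite eval_bidualE.
have [g [h [g0 h0 -> ->]]] := dual_join_split frechet_lcs x y f0.
by rewrite dual_xD; apply: lerD; [exact: xs|exact: ys].
Qed.

End FrechetTopology.

(** * Monotone sequences and nets *)

Section MonotoneSequences.
Variables (R : realType) (E : frechetLatticeType R) (x : nat -> E).
Hypothesis xinc : forall m n, (m <= n)%N -> rle (x m) (x n).
Hypothesis xbnd : tvs_bounded (range x).

Lemma dual_monotone_cvg (f : dual E) : cvgn (fun n => f (x n) : R).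
Proof.
have [g [h [g0 h0 ->]]] := dual_pos_decomposition (@frechet_lcs R E) f.
have cvg_pos k : dual_le 0 k -> cvgn (fun n => k (x n) : R).
  move=> k0; apply: nondecreasing_is_cvgn.
    by move=> m n mn; apply: dual_homo => //; exact: xinc.
  have [q cq kq] := dual_dominated (@frechet_lcs R E) k.
  have [C _ xC] := tvs_bounded_csn xbnd cq.
  exists C => _ [n _ <-]; apply: le_trans (xC (x n) _); last by exists n.
  exact: le_trans (ler_norm _) (kq _).
by apply: is_cvgB; exact: cvg_pos.
Qed.

Lemma bidual_monotone_limit : exists v : bidual E,
  forall f : dual E, (fun n => f (x n) : R) @ \oo --> (v f : R).
Proof.
pose phi (f : dual E) : R^o := limn (fun n => f (x n) : R).
have phiP (f : dual E) : (fun n => f (x n) : R) @ \oo --> phi f.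
  exact: dual_monotone_cvg.
have [|f e fe|v ve] := @bidual_intro R E phi (range x) _ xbnd.
- move=> a f g; apply: (cvg_unique (@Rhausdorff R) (phiP _)).
  by apply: cvgD (phiP g); apply: cvgM (phiP f); exact: cvg_cst.
- rewrite ler_norml; apply/andP; split.
    apply: (cvgr_to_ge (phiP f)); near=> n.
    have : `|f (x n) : R| <= e by apply: fe; exists n.
    by rewrite ler_norml => /andP[].
  apply: (cvgr_to_le (phiP f)); near=> n.
  have : `|f (x n) : R| <= e by apply: fe; exists n.
  by rewrite ler_norml => /andP[].
by exists v => f; rewrite ve.
Unshelve. all: by end_near. Qed.

Lemma bidual_monotone_sup (v : bidual E) :
  (forall f : dual E, (fun n => f (x n) : R) @ \oo --> (v f : R)) ->
  is_sup bidual_le (range (fun n => eval_bidual (x n))) v.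
Proof.
move=> vlim; split=> [_ [n _ <-] f f0|u ub f f0].
  rewrite eval_bidualE; apply: (cvgr_to_ge (vlim f)); exists n => // m /= nm.
  by apply: dual_homo => //; exact: xinc.
apply: (cvgr_to_le (vlim f)); near=> n.
by rewrite -eval_bidualE; apply: ub => //; exists n.
Unshelve. all: by end_near. Qed.

(** Dini's theorem: if the decreasing sequence [q (l - x n)] stayed above [e], a single positive
    functional would be at least [e] on every [l - x n], against weak convergence. *)
Lemma monotone_weak_cvg (l : E) :
  (forall f : dual E, (fun n => f (x n) : R) @ \oo --> (f l : R)) ->
  x @ \oo --> l.
Proof.
move=> xl; have xle n : rle (x n) l.
  apply: dual_sep => f f0; apply: (cvgr_to_ge (xl f)); exists n => // m /= nm.
  by apply: dual_homo => //; exact: xinc.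
apply: cvg_csn => q e cq e0; have [sq _] := cq.
have udec m n : (m <= n)%N -> rle (l - x n) (l - x m).
  by move=> mn; exact: rleD (rle_refl l) (rle_opp (xinc mn)).
have u0 n : rle 0 (l - x n) by exact: rsub_ge0.
have [[N qN]|nqN] := pselect (exists N, q (l - x N) < e).
  exists N => // n /= Nn; apply: le_lt_trans qN.
  by apply: riesz_seminorm_le => //; exact: udec.
have qe n : e <= q (l - x n).
  by rewrite leNgt; apply/negP => qn; apply: nqN; exists n.
have [f [f0 fe]] := dual_below_decreasing cq e0 u0 udec qe.
have [N _ fN] : \forall n \near \oo, `|f l - f (x n) : R| < e.
  by move/cvgrPdist_lt : (xl f); exact.
have := fN N (leqnn N); rewrite /= ltNge => /negP; case.
by rewrite -dual_xB; apply: le_trans (fe N) (ler_norm _).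
Qed.

End MonotoneSequences.

Lemma band_monotone_cvg (R : realType) (E : frechetLatticeType R) :
  is_band bidual_le (range (@eval_bidual R E)) ->
  forall x : nat -> E,
    (forall m n, (m <= n)%N -> rle (x m) (x n)) ->
    tvs_bounded (range x) ->
    exists l : E, x @ \oo --> l.
Proof.
move=> [_ band] x xinc xbnd.
have [v vlim] := bidual_monotone_limit xinc xbnd.
have [|l _ lv] := band _ _ _ (bidual_monotone_sup xinc vlim).
  by move=> _ [n _ <-]; exists (x n).
exists l; apply: monotone_weak_cvg => // f.
by rewrite -eval_bidualE lv; exact: vlim.
Qed.

Lemma tails_proper (I : Type) (le : I -> I -> Prop) :
  directed le -> ProperFilter (tails le).
Proof.
move=> [[i0 _] le_refl le_trans' le_dir].
apply: filter_from_proper => [|i _]; last by exists i; exact: le_refl.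
apply: filter_from_filter; first by exists i0.
move=> i j _ _; have [k ik jk] := le_dir i j; exists k => // l /= kl.
by split; [exact: le_trans' ik kl|exact: le_trans' jk kl].
Qed.

Lemma monotone_seq_net (R : realType) (E : frechetLatticeType R) :
  (forall x : nat -> E, (forall n, rle 0 (x n)) ->
    (forall m n, (m <= n)%N -> rle (x m) (x n)) ->
    tvs_bounded (range x) -> exists l : E, x @ \oo --> l) ->
  forall (I : Type) (le : I -> I -> Prop) (x : I -> E),
    directed le -> (forall i, rle 0 (x i)) ->
    (forall i j, le i j -> rle (x i) (x j)) ->
    tvs_bounded (range x) -> exists l : E, x @ tails le --> l.
Proof.
move=> seq_cvg I le x dle x0 xinc xbnd.
have [[i0 _] le_refl le_trans' _] := dle.
have FF := tails_proper dle.
apply: cauchy_csn => q e cq e0; have [sq _] := cq; have [qD _ _] := sq.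
have [[i ie]|ne] :=
    pselect (exists i, forall j, le i j -> q (x j - x i) < e / 2).
  exists [set j | le i j]; first by exists i.
  move=> j k /= ij ik; have -> : x j - x k = (x j - x i) - (x k - x i).
    by rewrite opprB addrA subrK.
  apply: le_lt_trans (riesz_seminormB sq _ _) _.
  by have := ie j ij; have := ie k ik; lra.
(* When no tail stays within [e / 2] of its first term, iterating this choice gives an increasing
   sequence with consecutive terms at least [e / 2] apart, which cannot converge. *)
have next i : exists j, le i j /\ e / 2 <= q (x j - x i).
  apply: contrapT => h; apply: ne; exists i => j ij.
  by rewrite ltNge; apply/negP => ej; apply: h; exists j.
have [s sP] := choice next.
pose a n := iter n s i0.
have ale m n : (m <= n)%N -> le (a m) (a n).
  move=> /subnK <-; elim: (n - m)%N => [|k IH]; first exact: le_refl.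
  by rewrite addSn; apply: le_trans' IH _; exact: (sP _).1.
have [|||l al] := seq_cvg (x \o a).
- by move=> n; exact: x0.
- by move=> m n mn; exact/xinc/ale.
- apply: csn_tvs_bounded => p cp; have [C _ xC] := tvs_bounded_csn xbnd cp.
  by exists C => _ [n _ <-]; apply: xC; exists (a n).
have e4 : 0 < e / 4 by rewrite divr_gt0.
have [N _ aN] := csn_cvg cq e4 al.
have := (sP (a N)).2; rewrite -/(a N.+1).
have -> : x (a N.+1) - x (a N) = (l - x (a N)) - (l - x (a N.+1)).
  by rewrite opprB [RHS]addrC addrA subrK.
have := riesz_seminormB sq (l - x (a N)) (l - x (a N.+1)).
have /= := aN N (leqnn _); have /= := aN N.+1 (leqnSn _); lra.
Qed.

(** * Components of elements of the bidual *)

Section Components.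
Variables (R : realType) (E : frechetLatticeType R).
Implicit Types (f g h : dual E) (q : E -> R).

(** By the Riesz-Kantorovich formula the meet of [g] and [k f] has at [c] the value
    [inf (g (c - v) + k f v)] over [0 <= v <= c], and the hypothesis says that this is at least
    [g c - e]. The cone encodes [h <= k f] and [g c - e <= h c]; the seminorm of [g] encodes
    [0 <= h <= g]. *)
Lemma dual_truncation f g (c : E) (k e : R) :
  dual_le 0 f -> dual_le 0 g -> rle 0 c -> 0 < k ->
  (forall v, rle 0 v -> rle v c -> g v - k * f v <= e) ->
  exists h, [/\ dual_le 0 h, dual_le h g, dual_le h (k *: f) & g c - e <= h c].
Proof.
move=> f0 g0 c0 k0 gfe.
pose K w r := exists v, exists2 t : R, 0 <= t &
  [/\ rle 0 v, w = t *: c - v & r = t * (g c - e) - k * f v].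
have cK : convex_cone K.
  split.
  - exists 0, 0 => //; split; first exact: rle_refl.
      by rewrite scale0r subr0.
    by rewrite mul0r dual_x0 mulr0 subr0.
  - move=> w1 r1 w2 r2 [v [s s0 [v0 -> ->]]] [w [t t0 [w0 -> ->]]].
    exists (v + w), (s + t); first by rewrite addr_ge0.
    split; first exact: rle_addr_nneg.
      by rewrite scalerDl opprD addrACA.
    by rewrite dual_xD; lra.
  - move=> a w r a0 [v [t t0 [v0 -> ->]]].
    exists (a *: v), (a * t); first by rewrite mulr_ge0// ltW.
    split; first by apply: rleZ_nneg => //; exact: ltW.
      by rewrite scalerBr scalerA.
    by rewrite dual_xZ; lra.
have cg := dual_abs_seminorm (@frechet_lcs R E) g0.
have [|h [h0 hg hK]] := dual_sandwich cg cK; last first.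
  exists h; split=> //.
  - by move=> x x0; have := hg x; rewrite rpos_id// rabs_id.
  - move=> x x0; have : K (- x) (- (k * f x)).
      by exists x, 0 => //; rewrite scale0r mul0r !sub0r.
    by move=> /hK; rewrite dual_xN lerN2 dualZE.
  - apply: hK; exists 0, 1 => //; split; first exact: rle_refl.
      by rewrite scale1r subr0.
    by rewrite mul1r dual_x0 mulr0 subr0.
move=> w r [v [t t0 [v0 -> ->]]]; rewrite rabs_id; last exact: rpos_ge0.
set p := rpos (t *: c - v).
(* The meet of [t c] and [v]. Divided by [t] it lies in [[0, c]], where the hypothesis applies. *)
pose m := t *: c - p.
have tc0 : rle 0 (t *: c) by exact: rleZ_nneg.
have m0 : rle 0 m.
  by apply: rsub_ge0; apply: rpos_le => //; exact: rle_subl.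
have mv : rle m v.
  rewrite /m; apply/rle_subrD; rewrite addrC; apply/rle_subrD.
  exact: rle_rpos.
have mc : rle m (t *: c) by apply/rle_subl/rpos_ge0.
have gp : g p = t * g c - g m :> R by rewrite dual_xB dual_xZ; lra.
have fm : k * f m <= k * f v by rewrite ler_pM2l//; exact: dual_homo.
rewrite gp; suff : g m - k * f m <= t * e by lra.
move: t0 mc; rewrite le_eqVlt => /orP[/eqP <-|t0 mc].
  rewrite scale0r mul0r => mc; rewrite (rle_anti mc m0) !dual_x0.
  by rewrite mulr0 subr0.
have ti0 : 0 <= t^-1 by rewrite invr_ge0 ltW.
have := gfe (t^-1 *: m) (rleZ_nneg ti0 m0).
have := rleZ2l ti0 mc; rewrite scalerA mulVf ?gt_eqF// scale1r => mc' /(_ mc').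
by rewrite !dual_xZ mulrCA -mulrBr ler_pdivrMl.
Qed.

(* The positive set of a Hahn decomposition of [z - eps b]: the functional
   [f1] is [f0] minus a maximal [h] in [[0, f0]] at which [z - eps b] is
   nonpositive. *)
Lemma dual_hahn (z : bidual E) (b : E) f0 :
  rle 0 b -> bidual_le 0 z -> bidual_le z (eval_bidual b) ->
  dual_le 0 f0 -> 0 < (z f0 : R) ->
  exists f1 (eps : R), [/\ dual_le 0 f1, 0 < eps, 0 < (f1 b : R) &
    forall g, dual_le 0 g -> dual_le g f1 -> eps * g b <= z g].
Proof.
move=> b0 z0 zb f00 zf0.
have fb0 : 0 < (f0 b : R) by apply: lt_le_trans zf0 _; exact: zb.
(* Then [eps * f0 b] is half of [z f0], so every [h] in the set [P] below leaves
   [z (f0 - h) >= z f0 / 2 > 0]. *)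
pose eps : R := z f0 / (2 * f0 b).
have eps0 : 0 < eps by rewrite divr_gt0// mulr_gt0.
pose P (h : dual E) := [/\ dual_le 0 h, dual_le h f0 & z h <= eps * h b].
pose T := {h : dual E | P h}.
pose le (h k : T) := `[< dual_le (sval h) (sval k) >].
have [||||[h [h0 hf zh]] hmax] := @Zorn T le.
- by move=> h; apply/asboolP; exact: dual_le_refl.
- move=> h k l /asboolP hk /asboolP kl; apply/asboolP.
  exact: dual_le_trans hk kl.
- move=> h k /asboolP hk /asboolP kh.
  move: h k hk kh => [h ph] [k pk] /= hk kh.
  by apply: eq_exist; exact: dual_le_anti.
- move=> A totA; have [[k0 Ak0]|A0] := pselect (exists k, A k); last first.
    have p0 : P 0.
      by split=> //; rewrite dual_x0 dual0E mulr0.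
    by exists (exist P _ p0) => h Ah; case: A0; exists h.
  pose A' := [set sval h | h in A].
  (* The chain gets an upper bound [h] with [h b <= sup B]. As [z <= b], the increment [z (h - k)]
     is at most [h b - k b], which is arbitrarily small for [k] in the chain; so [h] stays in
     [P]. *)
  pose B := [set (h b : R) | h in A'] : set R.
  have hsB : has_sup B.
    split; first by exists (sval k0 b : R), (sval k0) => //; exists k0.
    exists (f0 b : R) => _ [_ [h Ah <-] <-].
    by have [_ hf _] := svalP h; exact: hf.
  have cf0 := dual_abs_seminorm (@frechet_lcs R E) f00.
  have [|||||h [h0 hf0 Ah hS]] := @dual_chain_sup R E _ A' b (sup B) cf0.
  + by exists (sval k0), k0.
  + by move=> _ _ [h Ah <-] [k Ak <-];
      have [/asboolP|/asboolP] := totA _ _ Ah Ak; [left|right].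
  + move=> _ v [h Ah <-] v0; rewrite rabs_id//.
    by have [_ hf _] := svalP h; exact: hf.
  + exact: b0.
  + move=> _ v [h Ah <-] v0 vb; apply: (@le_trans _ _ (sval h b)).
      by have [h0 _ _] := svalP h; exact: dual_homo.
    by apply: ub_le_sup; [exact: hsB.2|exists (sval h) => //; exists h].
  have ph : P h.
    split=> // [x x0|]; first by have := hf0 x; rewrite rpos_id// rabs_id.
    apply/ler_addgt0Pr => e e0.
    have [_ [_ [k Ak <-] <-] kS] := sup_adherent e0 hsB.
    have [k0' kf zk] := svalP k.
    have hk : dual_le (sval k) h by apply: Ah; exists k.
    have := zb _ (dual_sub_ge0 hk); rewrite eval_bidualE dualBE dual_xB.
    have : eps * sval k b <= eps * h b by rewrite ler_pM2l//; exact: hk.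
    by move: zk kS hS; lra.
  by exists (exist P _ ph) => k Ak; apply/asboolP; apply: Ah; exists k.
exists (f0 - h), eps; split=> //; first exact: dual_sub_ge0.
  have : 0 < (z (f0 - h) : R).
    have : eps * h b <= eps * f0 b by rewrite ler_pM2l//; exact: (hf b).
    rewrite dual_xB.
    have -> : eps * f0 b = z f0 / 2.
      by rewrite /eps; field; rewrite gt_eqF.
    by have := zh; have := zf0; lra.
  by move=> /lt_le_trans; apply; apply: zb; exact: dual_sub_ge0.
move=> g g0 gf1; rewrite leNgt; apply/negP => zg.
(* If [z g < eps * g b], then [h + g] also belongs to [P]; maximality gives [g = 0], against the
   strict inequality. *)
have hg0 : dual_le 0 (h + g).
  by move=> x x0; rewrite dualDE dual0E addr_ge0//; [exact: (h0 x)|exact: g0].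
have hgf : dual_le (h + g) f0.
  by move=> x x0; have := gf1 x x0; rewrite dualBE dualDE; lra.
have zhg : z (h + g) <= eps * (h + g) b.
  by rewrite dual_xD dualDE; have := zh; have := zg; lra.
have p : P (h + g) by [].
have hhg : dual_le h (h + g).
  by move=> x x0; rewrite dualDE lerDl; exact: (g0 x).
have /(congr1 sval)/= : exist P _ p = exist P h (And3 h0 hf zh).
  by apply: hmax; apply/asboolP.
move=> /(congr1 (fun k => k - h)); rewrite addrAC subrr add0r => e.
by move: zg; rewrite e dual_x0 dual0E mulr0 ltxx.
Qed.

End Components.

(** * The Levi property and the band property *)

Definition levi_property (R : realType) (E : frechetLatticeType R) :=
  forall (I : Type) (le : I -> I -> Prop) (x : I -> E),
    directed le -> (forall i, rle 0 (x i)) ->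
    (forall i j, le i j -> rle (x i) (x j)) ->
    tvs_bounded (range x) -> exists l : E, x @ tails le --> l.

Section Levi.
Variables (R : realType) (E : frechetLatticeType R).
Implicit Types (f g h : dual E) (q : E -> R).

Hypothesis levi : levi_property E.

(** The elements of [D] above [a], indexed by themselves and shifted by [- a], form a positive
    increasing bounded net. Its limit, shifted back, is the supremum, and [D] comes close to it in
    every seminorm. *)
Lemma directed_sup (D : set E) (a : E) : D a ->
  (forall x y, D x -> D y -> exists z, [/\ D z, rle x z & rle y z]) ->
  (forall q, csn q -> exists C, forall x, D x -> rle a x -> q (x - a) <= C) ->
  exists l, is_sup rle D l /\
    forall q (e : R), csn q -> 0 < e -> exists2 x, D x & q (l - x) < e.
Proof.
move=> Da dirD bD.
pose I := {x : E | D x /\ rle a x}.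
pose le (i j : I) := rle (sval i) (sval j).
pose x (i : I) := sval i - a.
have dle : directed le.
  split.
  - by exists (exist _ a (conj Da (rle_refl a))).
  - by move=> i; exact: rle_refl.
  - by move=> j i k; exact: rle_trans.
  - move=> [y [Dy ay]] [z [Dz az]]; have [w [Dw yw zw]] := dirD _ _ Dy Dz.
    by exists (exist _ w (conj Dw (rle_trans ay yw))).
have [|||l xl] := levi dle (x := x).
- by move=> [y [Dy ay]]; exact: rsub_ge0.
- by move=> i j ij; exact: rleD2r.
- apply: csn_tvs_bounded => q cq; have [C bC] := bD q cq.
  by exists C => _ [[y [Dy ay]] _ <-]; exact: bC.
have FF := tails_proper dle.
exists (l + a); split; first split.
- move=> y Dy; have [z [Dz yz az]] := dirD _ _ Dy Da.
  apply/rle_subrD; apply: (cvg_rle_lower xl).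
  exists (exist _ z (conj Dz az)) => // -[w [Dw aw]] /= zw.
  by apply: rleD2r; exact: rle_trans yz zw.
- move=> u uD; have : rle l (u - a).
    apply: (cvg_rle_upper xl).
    exists (exist _ a (conj Da (rle_refl a))) => // -[w [Dw aw]] /= _.
    exact/rleD2r/uD.
  by move=> /(rleD2r a); rewrite subrK.
- move=> q e cq e0; have [[y [Dy ay]] /=] := filter_ex (csn_cvg cq e0 xl).
  by rewrite /x /= opprB addrA; exists y.
Qed.

Lemma dual_sup_approx (D : set E) (l : E) f (e : R) :
  (forall q (e : R), csn q -> 0 < e -> exists2 x, D x & q (l - x) < e) ->
  0 < e -> exists2 x, D x & `|f l - f x : R| < e.
Proof.
move=> h e0; have [q cq fq] := dual_dominated (@frechet_lcs R E) f.
have [x Dx qx] := h q e cq e0; exists x => //.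
by rewrite -dual_xB; apply: le_lt_trans qx.
Qed.

(** The elements [x] of [E] below [s] are directed upwards. Those above [a] are bounded: if [f]
    norms [x - a], then [q (x - a) = f (x - a) <= (s - a) f], and [bidual_bounded] controls the
    right side uniformly in [f]. Continuity of each functional keeps the supremum below [s]. *)
Lemma bidual_greatest (s : bidual E) (a : E) : bidual_le (eval_bidual a) s ->
  exists l, bidual_le (eval_bidual l) s /\
    forall x, bidual_le (eval_bidual x) s -> rle x l.
Proof.
move=> as_; pose D := [set x | bidual_le (eval_bidual x) s].
have [|x y Dx Dy|q cq|l [[lub _] lapp]] := @directed_sup D a.
- exact: as_.
- exists (rjoin x y); split; [|exact: rle_joinl|exact: rle_joinr].
  exact: bidual_join_le.
- have [M [C [bM C0 wM]]] := bidual_bounded (s - eval_bidual a).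
  have [K K0 qM] := tvs_bounded_csn bM cq; have [sq _] := cq.
  exists (C * (K + 1)) => x Dx ax.
  have [f [f0 fq fx]] := dual_norming (x - a) cq.
  rewrite -(rpos_id (rsub_ge0 ax)) -fx.
  have K1 : 0 < K + 1 by rewrite ltr_wpDl.
  apply: le_trans (wM f _ K1 _); last first.
    move=> y My; apply: le_trans (dual_le_norm sq fq y) _.
    by apply: le_trans (qM y My) _; rewrite lerDl.
  apply: le_trans (ler_norm _).
  by rewrite dualBE dual_xB lerB//; exact: Dx.
exists l; split; last exact: lub.
move=> f f0; apply/ler_addgt0Pr => e e0.
have [x Dx] := dual_sup_approx f lapp e0.
rewrite ltr_norml => /andP[_ fl]; have := Dx f f0; rewrite !eval_bidualE.
by move: fl; lra.
Qed.

(** Take [c = b - l] with [l] the supremum of the elements of [[0, b]] at which [f] vanishes. A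
    further such element [v] in [[0, c]] could be added to [l], so [v = 0]. *)
Lemma dual_carrier f (b : E) : dual_le 0 f -> rle 0 b ->
  exists c, [/\ rle 0 c, rle c b, f c = f b :> R &
    forall v, rle 0 v -> rle v c -> f v = 0 :> R -> v = 0].
Proof.
move=> f0 b0; pose D := [set d | [/\ rle 0 d, rle d b & f d = 0 :> R]].
have [|x y [x0 xb fx] [y0 yb fy]|q cq|l [[lub lmin] lapp]] := @directed_sup D 0.
- by split=> //; [exact: rle_refl|exact: dual_x0].
- exists (rjoin x y); split; [|exact: rle_joinl|exact: rle_joinr].
  have j0 : rle 0 (rjoin x y) by exact: rle_trans x0 (rle_joinl x y).
  split=> //; first exact: rjoin_le.
  apply/eqP; rewrite eq_le; apply/andP; split; last exact: f0.
  rewrite -[leRHS](addr0 0) -{1}fx -fy -dual_xD; apply: dual_homo => //.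
  apply: rjoin_le.
    by rewrite -[X in rle X _]addr0; exact: rleD (rle_refl x) y0.
  by rewrite -[X in rle X _]add0r; exact: rleD x0 (rle_refl y).
- exists (q b) => x [x0 xb _] _; rewrite subr0.
  by have [sq _] := cq; exact: riesz_seminorm_le.
have fl : f l = 0 :> R.
  apply/eqP; rewrite -normr_le0; apply/ler_addgt0Pr => e e0.
  have [x [_ _ fx]] := dual_sup_approx f lapp e0.
  by rewrite fx subr0 add0r => /ltW.
have l0 : rle 0 l.
  by apply: lub; split=> //; [exact: rle_refl|exact: dual_x0].
have lb : rle l b by apply: lmin => x [].
exists (b - l); split.
- exact: rsub_ge0.
- exact: rle_subl.
- by rewrite dual_xB fl subr0.
- move=> v v0 vbl fv; apply: (rle_anti _ v0).
  have : rle (v + l) l.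
    apply: lub; split; first exact: rle_addr_nneg.
      by move: vbl => /(rleD2r l); rewrite subrK.
    by rewrite dual_xD fv fl addr0.
  by move=> /(rleD2r (- l)); rewrite addrK subrr.
Qed.

(** [w] is the supremum of the partial sums of [v m + v m.+1 + ...], each truncated at [c]; a
    geometric sum bounds [f] on them. *)
Lemma dual_tail_sup f (c : E) (v : nat -> E) (G : R) m :
  dual_le 0 f -> 0 <= G -> rle 0 c ->
  (forall n, rle 0 (v n) /\ rle (v n) c) ->
  (forall n, f (v n) <= G * 2^-1 ^+ n) ->
  exists w, [/\ rle 0 w, rle w c, forall j, (m <= j)%N -> rle (v j) w &
    f w <= 2 * G * 2^-1 ^+ m].
Proof.
move=> f0 G0 c0 vc fv.
pose S k := \sum_(i < k) v (m + i)%N.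
pose W k := S k - rpos (S k - c).
have S0 k : rle 0 (S k).
  by elim/big_ind: (S k) => //; [exact: rle_refl|exact: rle_addr_nneg|
    move=> i _; exact: (vc _).1].
have Smono k l : (k <= l)%N -> rle (S k) (S l).
  move=> /subnK <-; elim: (l - k)%N => [|i IH]; first exact: rle_refl.
  rewrite addSn; apply: rle_trans IH _; rewrite /S big_ord_recr/=.
  by rewrite -[X in rle X _]addr0; exact: rleD (rle_refl _) (vc _).1.
have W0 k : rle 0 (W k) by exact: rmeet_ge.
have Wc k : rle (W k) c by exact: rmeet_ler.
have WS k : rle (W k) (S k) by exact: rmeet_lel.
have Wmono k l : (k <= l)%N -> rle (W k) (W l).
  by move=> kl; apply: rmeet_ge (Wc k); exact: rle_trans (WS k) (Smono _ _ kl).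
have fS k : f (S k) <= 2 * G * 2^-1 ^+ m - 2 * G * 2^-1 ^+ (m + k).
  elim: k => [|k IH]; first by rewrite /S big_ord0 dual_x0 addn0 subrr.
  rewrite /S big_ord_recr/= -/(S k) dual_xD addnS exprS.
  by have := fv (m + k)%N; have := IH; lra.
have [|x y [k _ <-] [l _ <-]|q cq|w [[wub wmin] wapp]] :=
    @directed_sup (range W) (W 0%N).
- by exists 0%N.
- by exists (W (maxn k l)); split;
    [exists (maxn k l)|exact/Wmono/leq_maxl|exact/Wmono/leq_maxr].
- exists (q c) => _ [k _ <-] Wk; have [sq _] := cq.
  apply: riesz_seminorm_le => //; first exact: rsub_ge0.
  exact: rle_trans (rle_subl _ (W0 0%N)) (Wc k).
exists w; split.
- by apply: rle_trans (W0 0%N) _; apply: wub; exists 0%N.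
- by apply: wmin => _ [k _ <-].
- move=> j mj; apply: (@rle_trans _ _ (W (j - m).+1)); last first.
    by apply: wub; exists (j - m).+1.
  apply: rmeet_ge; last exact: (vc j).2.
  rewrite /S big_ord_recr/= subnKC// -[X in rle X _]add0r.
  exact: rleD (S0 _) (rle_refl _).
- apply/ler_addgt0Pr => e e0; have [_ [k _ <-]] := dual_sup_approx f wapp e0.
  rewrite ltr_norml => /andP[_]; have := dual_homo f0 (WS k); have := fS k.
  have : 0 <= 2 * G * 2^-1 ^+ (m + k).
    by rewrite mulr_ge0 ?mulr_ge0// exprn_ge0// invr_ge0.
  by lra.
Qed.

(* Borel-Cantelli: otherwise some [v n] in [[0, c]] satisfy
   [f (v n) <= g c / 2 ^ n] and [g (v n) > e], and [f] vanishes at their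
   limit superior. *)
Lemma dual_absolutely_continuous f g (c : E) (e : R) :
  dual_le 0 f -> dual_le 0 g -> rle 0 c ->
  (forall v, rle 0 v -> rle v c -> f v = 0 :> R -> v = 0) -> 0 < e ->
  exists2 k : R, 0 < k & forall v, rle 0 v -> rle v c -> g v - k * f v <= e.
Proof.
move=> f0 g0 c0 fc e0; apply: contrapT => nk.
have /choice[v vP] n : exists v, [/\ rle 0 v, rle v c & e < g v - 2 ^+ n * f v].
  apply: contrapT => nv; apply: nk; exists (2 ^+ n); first by rewrite exprn_gt0.
  by move=> v v0 vc; rewrite leNgt; apply/negP => h; apply: nv; exists v.
have v0c n : rle 0 (v n) /\ rle (v n) c by have [? ? _] := vP n.
pose G : R := g c.
have G0 : 0 <= G by exact: g0.
have fv n : f (v n) <= G * 2^-1 ^+ n.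
  have [v0 vc gv] := vP n; have gc := dual_homo g0 vc.
  rewrite exprVn -ler_pdivrMr ?invr_gt0 ?exprn_gt0// invrK mulrC.
  by rewrite /G; lra.
have egv n : e < g (v n).
  have [v0 vc gv] := vP n; apply: lt_le_trans gv _.
  by rewrite gerBl mulr_ge0 ?exprn_ge0//; exact: f0.
have tail m := dual_tail_sup m f0 G0 c0 v0c fv.
(* Here [c - d] is an upper bound of a tail of [v]. With [l] the supremum of [D], the limit superior
   of [v] is therefore [c - l]. *)
pose D := [set d | [/\ rle 0 d, rle d c &
  exists m, forall j, (m <= j)%N -> rle (v j) (c - d)]].
have [|x y [x0 xc [m vx]] [y0 yc [n vy]]|q cq|l [[lub lmin] lapp]] :=
    @directed_sup D 0.
- split=> //; first exact: rle_refl.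
  by exists 0%N => j _; rewrite subr0; exact: (v0c j).2.
- exists (rjoin x y); split; [|exact: rle_joinl|exact: rle_joinr].
  split; [exact: rle_trans x0 (rle_joinl x y)|exact: rjoin_le|].
  have swap a b d : rle a (d - b) -> rle b (d - a).
    move=> /(rleD2r b); rewrite subrK => /(rleD2r (- a)).
    by rewrite addrAC subrr add0r.
  exists (maxn m n) => j; rewrite geq_max => /andP[mj nj]; apply: (swap).
  by apply: rjoin_le; apply: (swap); [exact: vx|exact: vy].
- exists (q c) => x [x0 xc _] _; rewrite subr0.
  by have [sq _] := cq; exact: riesz_seminorm_le.
have l0 : rle 0 l.
  apply: lub; split=> //; first exact: rle_refl.
  by exists 0%N => j _; rewrite subr0; exact: (v0c j).2.
have lc : rle l c by apply: lmin => x [].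
have fcl m : f (c - l) <= 2 * G * 2^-1 ^+ m.
  have [w [w0 wc vw fw]] := tail m; apply: le_trans fw; apply: dual_homo => //.
  apply/rle_subrD; rewrite addrC; apply/rle_subrD; apply: lub; split.
  - exact: rsub_ge0.
  - exact: rle_subl.
  - by exists m => j mj; rewrite subKr; exact: vw.
have fcl0 : f (c - l) = 0 :> R.
  apply/eqP; rewrite eq_le; apply/andP; split; last exact/f0/rsub_ge0.
  have cv0 : (fun m => 2 * G * 2^-1 ^+ m) @ \oo --> (2 * G * 0 : R).
    by apply: cvgM; [exact: cvg_cst|apply: cvg_expr; rewrite ger0_norm; lra].
  rewrite mulr0 in cv0; apply: (cvgr_to_ge cv0).
  by near=> m; exact: fcl.
have cl : l = c.
  have := fc (c - l) (rsub_ge0 lc) (rle_subl c l0) fcl0.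
  by move/eqP; rewrite subr_eq0 => /eqP.
(* As [D] approximates [c], some tail of [v] lies below a [c - d] with [g (c - d) < e], although
   [g (v m) > e]. *)
have [d [d0 dc [m vd]]] := dual_sup_approx g lapp e0.
rewrite cl -dual_xB ltr_norml => /andP[_ gd].
have := dual_homo g0 (vd m (leqnn m)); have := egv m.
by move: gd; lra.
Unshelve. all: by end_near. Qed.

(** The witness is [eps c], with [f] and [eps] from [dual_hahn] and [c] the carrier of [f] in
    [[0, b]]. For [g >= 0], absolute continuity with tolerance [e / eps] allows a truncation [h] of
    [g] below a multiple of [f], and then [eps g c - e <= eps h c <= eps h b <= z h <= z g]. *)
Lemma bidual_minorant (z : bidual E) (b : E) f0 :
  rle 0 b -> bidual_le 0 z -> bidual_le z (eval_bidual b) ->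
  dual_le 0 f0 -> 0 < (z f0 : R) ->
  exists x : E, [/\ rle 0 x, x <> 0 & bidual_le (eval_bidual x) z].
Proof.
move=> b0 z0 zb f00 zf0.
have [f [eps [fp eps0 fb zf]]] := dual_hahn b0 z0 zb f00 zf0.
have [c [c0 cb fc cmin]] := dual_carrier fp b0.
exists (eps *: c); split.
- by apply: rleZ_nneg => //; exact: ltW.
- move=> /(congr1 (fun x => f x : R)); rewrite dual_xZ fc dual_x0 => /eqP.
  by rewrite mulf_eq0 !gt_eqF.
move=> g g0; rewrite eval_bidualE dual_xZ; apply/ler_addgt0Pr => e e0.
have [|k k0 gk] := @dual_absolutely_continuous f g c (e / eps) fp g0 c0 cmin.
  by rewrite divr_gt0.
have [h [h0 hg hf gh]] := dual_truncation fp g0 c0 k0 gk.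
have kh0 : dual_le 0 (k^-1 *: h).
  move=> x x0; rewrite dualZE dual0E mulr_ge0// ?invr_ge0 ?(ltW k0)//.
  exact: h0.
have khf : dual_le (k^-1 *: h) f.
  by move=> x x0; rewrite dualZE ler_pdivrMl//; exact: hf.
have := zf _ kh0 khf; rewrite dualZE dual_xZ mulrCA ler_pM2l ?invr_gt0//.
have := z0 _ (dual_sub_ge0 hg); rewrite dual0E dual_xB.
have : eps * h c <= eps * h b by rewrite ler_pM2l//; exact: dual_homo.
have : eps * (g c - e / eps) <= eps * h c by rewrite ler_pM2l.
by rewrite mulrBr mulrCA divff ?gt_eqF// mulr1; lra.
Qed.

(** Let [x] be the largest element of [E] below [y]. If [y] exceeded [x], a nonzero minorant of
    [y - x] in [E] could be added to [x]. *)
Lemma bidual_interval (y : bidual E) (b : E) :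
  bidual_le 0 y -> bidual_le y (eval_bidual b) -> exists x, y = eval_bidual x.
Proof.
move=> y0 yb.
have e0 : eval_bidual (0 : E) = 0.
  by apply: dual_ext => f; rewrite eval_bidualE dual_x0.
have [|x [xy xmax]] := @bidual_greatest y 0; first by rewrite e0.
have x0 : rle 0 x by apply: xmax; rewrite e0.
exists x; apply: bidual_le_anti => // f f0.
rewrite leNgt; apply/negP => xyf.
have b0 : rle 0 b.
  apply: bidual_le_eval; rewrite e0 => g g0.
  exact: le_trans (y0 g g0) (yb g g0).
pose z := y - eval_bidual x.
have zE g : z g = y g - g x :> R by rewrite /z dualBE eval_bidualE.
have z0 : bidual_le 0 z.
  by move=> g g0; rewrite zE dual0E subr_ge0; exact: xy.
have zb : bidual_le z (eval_bidual b).
  move=> g g0; rewrite zE; apply: le_trans (yb g g0).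
  by rewrite gerBl; exact: g0.
have zf : 0 < (z f : R) by rewrite zE subr_gt0.
have [v [v0 vn0 vz]] := bidual_minorant b0 z0 zb f0 zf.
apply: vn0; apply: (rle_anti _ v0).
have : rle (v + x) x.
  apply: xmax => g g0; have := vz g g0.
  by rewrite zE !eval_bidualE dual_xD; lra.
by move=> /(rleD2r (- x)); rewrite addrK subrr.
Qed.

Lemma levi_band : is_band bidual_le (range (@eval_bidual R E)).
Proof.
have eD (a : R) (x y : E) : eval_bidual (a *: x + y) =
    a *: eval_bidual x + eval_bidual y.
  apply: dual_ext => f.
  by rewrite dualDE dualZE !eval_bidualE dual_xD dual_xZ.
split; first split.
- exists 0 => //; apply: dual_ext => f.
  by rewrite eval_bidualE dual_x0.
- by move=> a _ _ [x _ <-] [y _ <-]; exists (a *: x + y) => //; exact: eD.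
- move=> u y ax ay + ayP ayx [x _ ux]; rewrite -ux => axP.
  have axx : bidual_le ax (eval_bidual (rabs x)).
    apply: axP.2 => _ [->|->] f f0; rewrite ?dualNE !eval_bidualE.
      by apply: dual_homo => //; exact: rabs_ge.
    by rewrite -dual_xN; apply: dual_homo => //; exact: rabs_geN.
  have yle : bidual_le y (eval_bidual (rabs x)).
    move=> f f0; apply: le_trans (axx f f0); apply: le_trans (ayx f f0).
    by apply: ayP.1 => //; left.
  have yge : bidual_le (- y) (eval_bidual (rabs x)).
    move=> f f0; apply: le_trans (axx f f0); apply: le_trans (ayx f f0).
    by apply: ayP.1 => //; right.
  (* Adding [rabs x] moves [y] from [[- rabs x, rabs x]] into [[0, 2 rabs x]], an interval that
     starts at [0]. *)
  have [||w wE] :=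
    @bidual_interval (y + eval_bidual (rabs x)) (rabs x + rabs x).
  + by move=> f f0; have := yge f f0; rewrite dualNE dualDE dual0E; lra.
  + by move=> f f0; have := yle f f0; rewrite dualDE !eval_bidualE dual_xD; lra.
  exists (w - rabs x) => //; apply: dual_ext => f.
  have e : y f + f (rabs x) = f w :> R.
    by rewrite -[RHS]eval_bidualE -wE dualDE eval_bidualE.
  by rewrite eval_bidualE; apply/eqP; rewrite dual_xB subr_eq e.
- move=> A s AE [sub smin].
  have [[u Au]|A0] := pselect (exists u, A u); last first.
    (* A supremum of the empty set is below every element, in particular below [0] and below
       [s + s]; so it is [0]. *)
    exists 0 => //; apply: bidual_le_anti => f f0; last first.
      apply: smin => // u Au; by case: A0; exists u.
    have : s f <= (s + s) f by apply: smin => // u Au; case: A0; exists u.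
    by rewrite eval_bidualE dual_x0 dualDE; lra.
  have [a _ au] := AE u Au.
  (* The largest [l] in [E] below [s] bounds [A] from above, whence [s <= l]. *)
  have [|l [ls lmax]] := @bidual_greatest s a.
    by rewrite au; exact: sub.
  exists l => //; apply: bidual_le_anti => //; apply: smin => w Aw.
  have [x _ xw] := AE w Aw; rewrite -xw.
  by apply/eval_bidual_le/lmax; rewrite xw; exact: sub.
Qed.

End Levi.

(** * Weak compactness of order intervals *)

Lemma fmap_ultra (T U : Type) (f : T -> U) (F : set_system T) :
  UltraFilter F -> UltraFilter (f @ F).
Proof.
move=> UF; split; first exact: fmap_proper_filter.
move=> G PG FG; apply/seteqP; split=> // A GA.
have [//|FA] := in_ultra_setVsetC (f @^-1` A) UF.
have GCA : G (~` A) by exact: FG.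
by have [x []] := filter_ex (filterI GA GCA).
Qed.

Section WeakTopology.
Variables (R : realType) (E : preTopologicalLmodType R).

Let weak_embedding (x : E) : {ptws dual E -> R^o} := fun f => f x.

Lemma weak_eval_continuous (f : dual E) :
  continuous (f : weak_space E -> R^o).
Proof.
move=> x; apply: (@continuous_comp (weak_space E) {ptws dual E -> R^o} R^o
  weak_embedding (fun u => u f)); first exact: initial_continuous.
exact: (@proj_continuous (dual E) (fun _ => R^o : topologicalType) f).
Qed.

Lemma weak_cvg (F : set_system E) (x : E) : Filter F ->
  (forall f : dual E, (fun y => f y : R^o) @ F --> (f x : R^o)) ->
  F --> (x : weak_space E).
Proof.
move=> FF h; apply: (@cvg_initial _ _ weak_embedding).
apply/cvg_sup => f; apply: (@cvg_initial _ _ (fun u : dual E -> R^o => u f)).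
exact: h.
Qed.

End WeakTopology.

Section NormedDual.
Variables (R : realType) (X : normedModType R).

Lemma norm_sublinear : sublinear (fun x : X => `|x|).
Proof.
split=> [x y|a x a0]; first exact: ler_normD.
by rewrite normrZ ger0_norm.
Qed.

Lemma norm_dual_sep (x : X) : (forall f : dual X, f x = 0 :> R) -> x = 0.
Proof.
move=> fx; have [|f [fn fK]] :=
    Mazur_Orlicz norm_sublinear (ray_cone x `|x|).
  by move=> v c [t t0 [-> ->]]; rewrite normrZ ger0_norm.
have fle y : `|f y : R| <= `|y|.
  by rewrite ler_norml fn lerNl -raddfN -(normrN y) fn.
have cf : continuous (f : X -> R^o).
  move=> y; apply/cvgrPdist_lt => e e0.
  have := @cvg_id _ (nbhs y) => /cvgrPdist_lt/(_ e e0).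
  apply: filterS => z; apply: le_lt_trans.
  by rewrite -raddfB; exact: fle.
have [g gf] := dual_is_linear (linearP f) cf.
apply/eqP; rewrite -normr_le0 -(fx g) gf; apply: fK.
by exists 1 => //; rewrite scale1r mul1r.
Qed.

Lemma weak_hausdorff : hausdorff_space (weak_space X).
Proof.
move=> x y xy; apply/eqP; rewrite -subr_eq0; apply/eqP/norm_dual_sep => f.
rewrite dual_xB; apply/eqP; rewrite subr_eq0; apply/eqP.
apply: (@Rhausdorff R) => A B fA fB.
have [z [Az Bz]] := xy _ _ (weak_eval_continuous fA) (weak_eval_continuous fB).
by exists (f z).
Qed.

End NormedDual.

Section WeakCompactness.
Variables (R : realType) (E : frechetLatticeType R).

Hypothesis levi : levi_property E.

(** Along an ultrafilter on the interval every functional converges, by compactness of real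
    segments. The limit, shifted by [a], is an element of the bidual between [0] and [b - a], hence
    a point of [E]. *)
Lemma interval_weakly_compact (a b : E) :
  compact ([set x | rle a x /\ rle x b] : set (weak_space E)).
Proof.
rewrite compact_ultra => F UF FK.
pose M := [set x : E | rle 0 x /\ rle x (b - a)].
have bM : tvs_bounded M.
  apply: csn_tvs_bounded => q cq; exists (q (b - a)) => x [x0 xb].
  by have [sq _] := cq; exact: riesz_seminorm_le.
have FM : F [set x | M (x - a)].
  apply: filterS FK => x [ax xb]; split; first exact: rsub_ge0.
  exact: rleD2r.
have cvf (f : dual E) : exists r : R^o, (fun x : E => f x : R^o) @ F --> r.
  have [q cq fq] := dual_dominated (@frechet_lcs R E) f.
  pose C := q (b - a) + `|f a : R|.
  have := @segment_compact R (- C) C; rewrite compact_ultra.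
  move=> /(_ ((fun x : E => f x : R^o) @ F)) [||r [_ rl]]; last by exists r.
    exact: fmap_ultra.
  apply: (@filterS _ F _ _ _ _ FM) => x [x0 xb] /=; rewrite in_itv/= -ler_norml.
  have -> : f x = f (x - a) + f a :> R by rewrite -dual_xD subrK.
  apply: le_trans (ler_normD _ _) _; rewrite lerD2r.
  apply: le_trans (fq _) _; have [sq _] := cq.
  exact: riesz_seminorm_le.
have [phi phiP] := choice cvf.
have phiB (f : dual E) :
    (fun x : E => f (x - a) : R^o) @ F --> (phi f - f a : R^o).
  have -> : (fun x : E => f (x - a) : R^o) = (fun x : E => (f x : R^o) - f a).
    by apply/funext => x; rewrite dual_xB.
  by apply: cvgB (phiP f) _; exact: cvg_cst.
have [||w wE] := @bidual_intro R E (fun f : dual E => phi f - f a) M _ bM.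
- move=> t f g; apply: (cvg_unique (@Rhausdorff R) (phiB _)).
  by apply: cvgD (phiB g); apply: cvgM (phiB f); exact: cvg_cst.
- move=> f e fe; rewrite ler_norml; apply/andP; split.
    apply: (cvgr_to_ge (phiB f)); apply: filterS FM => x /fe.
    by rewrite ler_norml => /andP[].
  apply: (cvgr_to_le (phiB f)); apply: filterS FM => x /fe.
  by rewrite ler_norml => /andP[].
have [||y wy] := @bidual_interval R E levi w (b - a).
- move=> f f0; rewrite wE; apply: (cvgr_to_ge (phiB f)).
  by apply: filterS FM => x [x0 _]; exact: f0.
- move=> f f0; rewrite wE; apply: (cvgr_to_le (phiB f)).
  by apply: filterS FM => x [_ xb]; exact: dual_homo.
have phiE (f : dual E) : phi f = f (y + a) :> R.
  rewrite dual_xD; have := wE f; rewrite wy eval_bidualE => ->.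
  by rewrite subrK.
exists (y + a); split; last first.
  by apply: weak_cvg => f; rewrite -phiE; exact: phiP.
split; apply: dual_sep => f f0; rewrite -phiE.
  apply: (cvgr_to_ge (phiP f)); apply: filterS FK => x [ax _].
  exact: dual_homo.
apply: (cvgr_to_le (phiP f)); apply: filterS FK => x [_ xb].
exact: dual_homo.
Qed.

(** By [bidual_greatest], applied to [v] and to [- u], the set [A] lies in an order interval of [E].
    Its image under the weakly continuous [T] is weakly compact, and closed because the weak
    topology of [X] is Hausdorff. *)
Lemma levi_gen_b_weakly_compact (X : completeNormedModType R)
  (T : {linear E -> X}) : continuous T -> gen_b_weakly_compact T.
Proof.
move=> cT A [u [v Auv]].
(* A point of [A] is needed as the initial element of [E] below [v], and its opposite below
   [- u]. *)
have [[x0 Ax0]|A0] := pselect (exists x, A x); last first.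
  have -> : T @` A = set0.
    by rewrite -subset0 => y [x Ax _]; apply: A0; exists x.
  by rewrite /relatively_weakly_compact closure0; exact: compact0.
have [|b [_ bmax]] := @bidual_greatest _ _ levi v x0.
  exact: (Auv _ Ax0).2.
have [|a [_ amax]] := @bidual_greatest _ _ levi (- u) (- x0).
  move=> f f0; rewrite eval_bidualE dual_xN dualNE lerN2.
  exact: (Auv _ Ax0).1.
pose K : set (weak_space E) := [set x | rle (- a) x /\ rle x b].
have AK : A `<=` K.
  move=> x Ax; split; last exact/bmax/(Auv _ Ax).2.
  rewrite -[x]opprK; apply/rle_opp/amax => f f0.
  rewrite eval_bidualE dual_xN dualNE lerN2.
  exact: (Auv _ Ax).1.
have cTw : continuous (T : weak_space E -> weak_space X).
  move=> x; have FF : Filter (nbhs (x : weak_space E)) := nbhs_filter _.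
  apply: weak_cvg => f.
  have lfT : linear ((f : X -> R^o) \o T).
    by move=> t y z; rewrite /= linearP dual_xD dual_xZ.
  have cfT : continuous ((f : X -> R^o) \o T).
    by move=> y; apply: continuous_comp; [exact: cT|exact: dual_continuous].
  have [g gE] := dual_is_linear lfT cfT.
  have := @weak_eval_continuous R E g x.
  by rewrite /continuous_at gE.
have cTK : compact (T @` K : set (weak_space X)).
  apply: continuous_compact (@interval_weakly_compact (- a) b).
  exact: continuous_subspaceT.
apply: subclosed_compact (cTK) _; first exact: closed_closure.
have /closure_id -> := compact_closed (@weak_hausdorff R X) cTK.
exact/closureS/image_subset.
Qed.

End WeakCompactness.

(** * Positive operators *)

Lemma lattice_norm_seminorm (R : realType) (F : banachLatticeType R) :
  riesz_seminorm (fun x : F => `|x|).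
Proof.
by split; [exact: ler_normD|exact: normrZ|exact: lattice_norm].
Qed.

Section PositiveOperators.
Variables (R : realType) (E : frechetLatticeType R) (F : banachLatticeType R).
Variable T : {linear E -> F}.
Hypothesis T0 : forall x : E, rle 0 x -> rle 0 (T x).

Lemma positive_homo x y : rle x y -> rle (T x) (T y).
Proof. by move=> /rsub_ge0/T0; rewrite raddfB; exact: rle_of_sub. Qed.

Lemma positive_norm_homo x y : rle 0 x -> rle x y -> `|T x| <= `|T y|.
Proof.
move=> x0 xy; apply: (riesz_seminorm_le (lattice_norm_seminorm F)).
  exact: T0.
exact: positive_homo.
Qed.

Lemma positive_norm_abs x : `|T x| <= `|T (rabs x)|.
Proof.
rewrite -(riesz_seminorm_abs (lattice_norm_seminorm F) (T x)).
apply: (riesz_seminorm_le (lattice_norm_seminorm F)); first exact: rabs_ge0.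
apply: rjoin_le; first exact/positive_homo/rabs_ge.
by rewrite -raddfN; apply/positive_homo; exact: rabs_geN.
Qed.

(** Otherwise there are [x n >= 0] so small that their series converges, with [|T (x n)| > n]. The
    sum [l] dominates every [x n], so [|T l|] exceeds every [n]. *)
Lemma positive_bounded_near0 (r : nat -> E -> R) :
  (forall n, csn (r n)) ->
  (forall U : set E, nbhs 0 U -> exists n, [set x | r n x < 1] `<=` U) ->
  exists n : nat, forall x, rle 0 x ->
    (forall i : 'I_n.+1, r i x < 2^-1 ^+ n) -> `|T x| <= n%:R.
Proof.
move=> cr rbase; apply: contrapT => nT.
have /choice[x xP] n : exists x, [/\ rle 0 x,
    forall i, (i <= n)%N -> r i x < 2^-1 ^+ n & n%:R < `|T x|].
  apply: contrapT => nx; apply: nT; exists n => x x0 rx.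
  rewrite leNgt; apply/negP => h; apply: nx; exists x; split=> // i ni.
  by have := rx (Ordinal (ni : i < n.+1)%N).
pose S k := \sum_(i < k) x i.
have Sr m k j : (m <= k)%N ->
    r m (S (k + j)%N - S k) <= 2 * 2^-1 ^+ k - 2 * 2^-1 ^+ (k + j).
  move=> mk; elim: j => [|j IH].
    by rewrite addn0 !subrr (riesz_seminorm0 (cr m).1).
  rewrite addnS /S big_ord_recr/= -!/(S _) addrAC exprS.
  have [[rD _ _] _] := cr m.
  have [_ xr _] := xP (k + j)%N.
  have := rD (S (k + j)%N - S k) (x (k + j)%N).
  have := xr m (leq_trans mk (leq_addr _ _)).
  by move: IH; lra.
have [l Sl] : exists l : E, S @ \oo --> l.
  apply: cauchy_csn => q e cq e0; have [sq q0] := cq.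
  have [m rm] := rbase _ (q0 e e0).
  (* From index [2] on, the tail bound [2 * 2^-1 ^+ k] is at most [1 / 2], which is below the radius
     [1]. *)
  have Sq k j : (maxn m 2 <= k)%N -> (k <= j)%N -> q (S j - S k) < e.
    rewrite geq_max => /andP[mk k2] kj; apply: rm => /=.
    rewrite -(subnKC kj); apply: le_lt_trans (Sr m k _ mk) _.
    have : (2^-1 : R) ^+ k <= 2^-1 ^+ 2.
      by apply: ler_wiXn2l => //; lra.
    have : 0 <= (2^-1 : R) ^+ (k + (j - k)) by rewrite exprn_ge0// invr_ge0.
    by rewrite expr2; lra.
  exists [set k | (maxn m 2 <= k)%N]; first by exists (maxn m 2).
  move=> i j /= mi mj; have [ij|/ltnW ji] := leqP i j; last exact: Sq.
  by rewrite -(riesz_seminormN sq) opprB; exact: Sq.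
have Smono k j : (k <= j)%N -> rle (S k) (S j).
  move=> /subnK <-; elim: (j - k)%N => [|i IH]; first exact: rle_refl.
  rewrite addSn; apply: rle_trans IH _; rewrite /S big_ord_recr/=.
  rewrite -[X in rle X _]addr0; apply: rleD (rle_refl _) _.
  by have [] := xP (i + k)%N.
have S0 k : rle 0 (S k).
  by have := Smono 0%N k isT; rewrite {1}/S big_ord0.
have xl n : rle (x n) l.
  apply: (cvg_rle_lower Sl); exists n.+1 => // k /= nk.
  apply: rle_trans _ (Smono _ _ nk); rewrite /S big_ord_recr/=.
  by rewrite -[X in rle X _]add0r; exact: rleD (S0 n) (rle_refl _).
have [x0 _ nTx] := xP (Num.bound `|T l|).
have := positive_norm_homo x0 (xl _); rewrite leNgt => /negP; apply.
by apply: lt_trans nTx; exact: archi_boundP.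
Qed.

Lemma positive_continuous : continuous T.
Proof.
have [r [cr rbase]] := frechet_base E.
have [n Tn] := positive_bounded_near0 cr rbase.
have n1 : 0 < n.+1%:R :> R by [].
move=> y; apply/cvgrPdist_lt => e e0.
(* The estimate will be [|T w| <= d * n], which is strictly below [e]. *)
pose d := e / n.+1%:R.
have d0 : 0 < d by rewrite divr_gt0.
have V0 : nbhs (0 : E) [set z | forall i : 'I_n.+1, r i z < d * 2^-1 ^+ n].
  apply: filter_forall => i; apply: (cr i).2.
  by rewrite mulr_gt0// exprn_gt0// invr_gt0.
apply: filterS (nbhs0_translate y V0) => z /= rz.
rewrite distrC -raddfB; set w := z - y.
have : `|T (rabs (d^-1 *: w))| <= n%:R.
  apply: Tn; first exact: rabs_ge0.
  move=> i; have [sr _] := cr i; have [_ rZ _] := sr.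
  by rewrite (riesz_seminorm_abs sr) rZ gtr0_norm ?invr_gt0// ltr_pdivrMl.
move=> /(le_trans (positive_norm_abs _)).
rewrite linearZ normrZ gtr0_norm ?invr_gt0// ler_pdivrMl//.
move=> /le_lt_trans; apply.
by rewrite /d mulrAC ltr_pdivrMr// ltr_pM2l// ltr_nat.
Qed.

End PositiveOperators.

(** * The Banach lattice of bounded functions *)

Section BoundedFunctions.
Variables (R : realType) (I : Type).

Definition bounded_pred : {pred I -> R^o} :=
  fun f => `[< exists M : R, forall i, `|f i : R| <= M >].

Lemma bounded_pred_submod_closed : submod_closed bounded_pred.
Proof.
split=> [|a f g /asboolP[M fM] /asboolP[N gN]]; apply/asboolP.
  by exists 0 => i; rewrite normr0.
exists (`|a| * M + N) => i; apply: le_trans (ler_normD _ _) _.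
by rewrite lerD// normrM ler_wpM2l.
Qed.

HB.instance Definition _ :=
  GRing.isSubmodClosed.Build R (I -> R^o) bounded_pred
    bounded_pred_submod_closed.

Record bounded_function := BoundedFunction {
  bounded_function_val :> I -> R^o;
  _ : bounded_function_val \in bounded_pred }.

HB.instance Definition _ := [isSub for bounded_function_val].
HB.instance Definition _ := [Choice of bounded_function by <:].
HB.instance Definition _ := [SubChoice_isSubLmodule of bounded_function by <:].

Implicit Types f g : bounded_function.

Lemma bounded_functionP f : exists M : R, forall i, `|f i : R| <= M.
Proof. by case: f => f /= /asboolP. Qed.

Lemma bounded_function_ext f g : (forall i, f i = g i) -> f = g.
Proof. by move=> fg; apply: val_inj; apply/funext. Qed.

Lemma bounded_function_intro (h : I -> R^o) (M : R) :
  (forall i, `|h i : R| <= M) -> exists f, forall i, f i = h i.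
Proof.
move=> hM; have p : h \in bounded_pred by apply/asboolP; exists M.
by exists (BoundedFunction p).
Qed.

(* [0] is included so that the supremum is over a nonempty set. *)
Definition sup_norm f : R := sup [set r | r = 0 \/ exists i, r = `|f i : R|].

Let has_sup_norm f : has_sup [set r | r = 0 \/ exists i, r = `|f i : R|].
Proof.
split; first by exists 0; left.
have [M fM] := bounded_functionP f; exists (Num.max 0 M) => _ [->|[i ->]].
  by rewrite le_max lexx.
by rewrite le_max fM orbT.
Qed.

Lemma sup_norm_ge f i : `|f i : R| <= sup_norm f.
Proof. by apply: ub_le_sup; [exact: (has_sup_norm f).2|right; exists i]. Qed.

Lemma sup_norm_ge0 f : 0 <= sup_norm f.
Proof. by apply: ub_le_sup; [exact: (has_sup_norm f).2|left]. Qed.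

Lemma sup_norm_le f (M : R) :
  0 <= M -> (forall i, `|f i : R| <= M) -> sup_norm f <= M.
Proof.
move=> M0 fM; apply: ge_sup; first by exists 0; left.
by move=> _ [->|[i ->]].
Qed.

Lemma sup_normD f g : sup_norm (f + g) <= sup_norm f + sup_norm g.
Proof.
apply: sup_norm_le => [|i]; first by rewrite addr_ge0// sup_norm_ge0.
by apply: le_trans (ler_normD _ _) _; rewrite lerD// sup_norm_ge.
Qed.

Lemma sup_normZ (a : R) f : sup_norm (a *: f) = `|a| * sup_norm f.
Proof.
have le b g : sup_norm (b *: g) <= `|b| * sup_norm g.
  apply: sup_norm_le => [|i]; first by rewrite mulr_ge0// sup_norm_ge0.
  by rewrite normrM ler_wpM2l// sup_norm_ge.
apply/eqP; rewrite eq_le le/=; have [->|a0] := eqVneq a 0.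
  by rewrite normr0 mul0r sup_norm_ge0.
have := le a^-1 (a *: f); rewrite scalerA mulVf// scale1r normfV.
by rewrite ler_pdivlMl ?normr_gt0.
Qed.

Lemma sup_norm_eq0 f : sup_norm f = 0 -> f = 0.
Proof.
move=> f0; apply: bounded_function_ext => i; apply/eqP; rewrite -normr_le0.
by apply: le_trans (sup_norm_ge f i) _; rewrite f0.
Qed.

HB.instance Definition _ := Lmodule_isNormed.Build R bounded_function
  sup_normD sup_normZ sup_norm_eq0.

Lemma bounded_function_normE f : `|f| = sup_norm f. Proof. by []. Qed.

(** Coordinates converge by completeness of the reals, and a Cauchy estimate passes to the limit in
    one of its two functions, uniformly in the coordinate. *)
Lemma bounded_function_complete (F : set_system bounded_function) :
  ProperFilter F -> cauchy F -> cvg F.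
Proof.
move=> FF cF.
have small (e : R) : 0 < e ->
    exists2 A, F A & forall f g, A f -> A g -> `|f - g| < e.
  move=> e0; have := cF _ (entourage_ball _ (PosNum e0)).
  move=> [[P Q] /= [FP FQ] PQ]; exists (P `&` Q); first exact: filterI.
  move=> f g [Pf _] [_ Qg]; have /= := PQ (f, g) (conj Pf Qg).
  by rewrite -ball_normE.
have evB i f g : `|(f i : R) - g i| <= `|f - g| by exact: (sup_norm_ge (f - g)).
have cvi i : exists r : R^o, (fun f : bounded_function => f i : R^o) @ F --> r.
  suff : cvg ((fun f : bounded_function => f i : R^o) @ F) by move=> /cvg_ex.
  apply: cauchy_cvg => V; rewrite -entourage_ballE => -[e /= e0 eV].
  have [A FA Ae] := small e e0.
  exists ((fun f : bounded_function => f i : R^o) @` A,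
          (fun f : bounded_function => f i : R^o) @` A).
    by split; apply: (@filterS _ F _ _ _ _ FA) => f Af; exists f.
  move=> [u v] [/= [f Af <-] [g Ag <-]]; apply: eV; rewrite /= -ball_normE /=.
  exact: le_lt_trans (evB i f g) (Ae _ _ Af Ag).
have [h hP] := choice cvi.
have hA (e : R) A f i : F A -> (forall f g, A f -> A g -> `|f - g| < e) ->
    A f -> `|(f i : R) - h i| <= e.
  move=> FA Ae Af.
  have c : (fun g : bounded_function => `|(f i : R^o) - g i|) @ F -->
      `|(f i : R) - h i|.
    by apply: cvg_norm; apply: cvgB (hP i); exact: cvg_cst.
  apply: (cvgr_to_le c); apply: (@filterS _ F _ _ _ _ FA) => g Ag.
  by apply: le_trans (evB i f g) (ltW _); exact: Ae.
have [A FA A1] := small 1 ltr01; have [f0 Af0] := filter_ex FA.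
have [M fM] := bounded_functionP f0.
have [g gh] : exists g : bounded_function, forall i, g i = h i.
  apply: (@bounded_function_intro _ (M + 1)) => i.
  have -> : h i = (f0 i : R) - ((f0 i : R) - h i) by rewrite subKr.
  by apply: le_trans (ler_normB _ _) _; rewrite lerD//; exact: hA FA A1 Af0.
apply/cvg_ex; exists g; apply/cvgrPdist_le => e e0.
have [B FB Be] := small e e0.
apply: (@filterS _ F _ _ _ _ FB) => f Bf.
rewrite bounded_function_normE; apply: sup_norm_le => [|i]; first exact: ltW.
by rewrite distrC; have := hA e B f i FB Be Bf; rewrite -gh.
Qed.

HB.instance Definition _ := Uniform_isComplete.Build bounded_function
  bounded_function_complete.

Definition bounded_function_le f g := forall i, (f i : R) <= g i.

Lemma bounded_function_maxP f g :
  exists h : bounded_function, forall i, h i = Num.max (f i : R) (g i) :> R.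
Proof.
have [M fM] := bounded_functionP f; have [N gN] := bounded_functionP g.
apply: (@bounded_function_intro _ (Num.max M N)) => i.
by case: (leP (f i : R) (g i)) => _; rewrite le_max ?fM ?gN ?orbT.
Qed.

Definition bounded_function_join f g : bounded_function :=
  sval (cid (bounded_function_maxP f g)).

Lemma bounded_function_joinE f g i :
  bounded_function_join f g i = Num.max (f i : R) (g i) :> R.
Proof. exact: svalP (cid (bounded_function_maxP f g)) i. Qed.

Lemma bounded_function_le_refl f : bounded_function_le f f.
Proof. by move=> i. Qed.

Lemma bounded_function_le_anti f g :
  bounded_function_le f g -> bounded_function_le g f -> f = g.
Proof.
move=> fg gf; apply: bounded_function_ext => i.
by apply/eqP; rewrite eq_le fg gf.
Qed.

Lemma bounded_function_le_trans g f h :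
  bounded_function_le f g -> bounded_function_le g h -> bounded_function_le f h.
Proof. by move=> fg gh i; exact: le_trans (fg i) (gh i). Qed.

Lemma bounded_function_joinP f g :
  is_sup bounded_function_le [set f; g] (bounded_function_join f g).
Proof.
split=> [_ [->|->] i|h ub i].
- by rewrite bounded_function_joinE le_max lexx.
- by rewrite bounded_function_joinE le_max lexx orbT.
by rewrite bounded_function_joinE ge_max (ub f (or_introl erefl) i)/=;
  exact: (ub g (or_intror erefl) i).
Qed.

Lemma bounded_function_leD2r h f g :
  bounded_function_le f g -> bounded_function_le (f + h) (g + h).
Proof. by move=> fg i; rewrite lerD2r; exact: fg. Qed.

Lemma bounded_function_leZ2l (a : R) f g :
  0 <= a -> bounded_function_le f g -> bounded_function_le (a *: f) (a *: g).
Proof. by move=> a0 fg i; exact: ler_wpM2l a0 _ _ (fg i). Qed.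

Lemma bounded_function_archimedean f g : bounded_function_le 0 f ->
  (forall n : nat, bounded_function_le g (n.+1%:R^-1 *: f)) ->
  bounded_function_le g 0.
Proof.
move=> f0 gf i; apply/ler_addgt0Pr => e e0; rewrite add0r.
have fi : 0 <= (f i : R) by exact: f0.
have := archi_boundP (divr_ge0 fi (ltW e0)); set n := Num.bound _ => nfe.
apply: le_trans (gf n i) _.
rewrite -[leLHS]/(n.+1%:R^-1 * (f i : R)) ler_pdivrMl//.
move: nfe; rewrite ltr_pdivrMr// => /ltW/le_trans; apply.
by rewrite ler_wpM2r// ?ler_nat// ltW.
Qed.

HB.instance Definition _ := isRieszSpace.Build R bounded_function
  bounded_function_le_refl bounded_function_le_anti bounded_function_le_trans
  bounded_function_joinP bounded_function_leD2r bounded_function_leZ2l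
  bounded_function_archimedean.

Lemma bounded_function_absE f i : rabs f i = `|f i : R| :> R.
Proof.
rewrite -[LHS]/(bounded_function_join f (- f) i : R) bounded_function_joinE.
by rewrite -[(- f) i]/(- (f i : R)) maxrN.
Qed.

Lemma bounded_function_lattice_norm f g : rle (rabs f) (rabs g) -> `|f| <= `|g|.
Proof.
move=> fg; rewrite !bounded_function_normE; apply: sup_norm_le => [|i].
  exact: sup_norm_ge0.
apply: le_trans (sup_norm_ge g i); rewrite -!bounded_function_absE.
exact: fg.
Qed.

HB.instance Definition _ := isBanachLattice.Build R bounded_function
  bounded_function_lattice_norm.

End BoundedFunctions.

(** * Monotone convergence from weak compactness of positive operators *)

Lemma csn_norm (R : realType) (F : banachLatticeType R) :
  csn (fun x : F => `|x|).
Proof.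
split=> [|e e0]; first exact: lattice_norm_seminorm.
have := @cvg_id _ (nbhs (0 : F)) => /cvgrPdist_lt/(_ e e0).
by apply: filterS => x; rewrite sub0r normrN.
Qed.

Lemma bounded_function_coordinate (R : realType) (I : Type) (i : I) :
  exists phi : dual (bounded_function R I),
    forall f : bounded_function R I, phi f = f i :> R.
Proof.
have lin : linear (fun f : bounded_function R I => f i : R^o) by [].
have cont : continuous (fun f : bounded_function R I => f i : R^o).
  move=> f; have FF : Filter (nbhs f) := nbhs_filter f.
  apply/(@cvgrPdist_lt _ _ _ (nbhs f) FF) => e e0.
  have /(@cvgrPdist_lt _ _ _ (nbhs f) FF)/(_ e e0) := @cvg_id _ (nbhs f).
  apply: (@filterS _ (nbhs f) FF) => g; apply: le_lt_trans.
  exact: (sup_norm_ge (f - g)).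
by have [phi phiE] := dual_is_linear lin cont; exists phi; rewrite phiE.
Qed.

(** Along an increasing sequence, a cluster value of [phi (u n)] is the limit from below. *)
Lemma weak_cluster_below (R : realType) (F : rieszTvsType R) (u : nat -> F)
    (y : F) (phi : dual F) :
  (forall m n, (m <= n)%N -> rle (u m) (u n)) ->
  cluster (u @ \oo : set_system (weak_space F)) y -> dual_le 0 phi ->
  (forall n, phi (u n) <= phi y :> R) /\
  forall e, 0 < e -> exists n, (phi y : R) - phi (u n) < e.
Proof.
move=> uinc uy phi0.
have near e : 0 < e -> nbhs (y : weak_space F)
    [set z | `|(phi y : R) - phi z| < e].
  move=> e0; have FF : Filter (nbhs (y : weak_space F)) := nbhs_filter _.
  by have /cvgrPdist_lt/(_ e e0) := @weak_eval_continuous R F phi y.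
have get e n : 0 < e ->
    exists2 m, (n <= m)%N & `|(phi y : R) - phi (u m)| < e.
  move=> e0; have [|z [[m nm <-] ym]] :=
      uy (u @` [set m | (n <= m)%N]) _ _ (near e e0).
    by exists n => // m /= nm; exists m.
  by exists m.
split=> [n|e e0].
  apply/ler_addgt0Pr => e e0; have [m nm] := get e n e0.
  rewrite ltr_norml => /andP[ym _].
  by have := dual_homo phi0 (uinc _ _ nm); move: ym; lra.
have [m _] := get e 0%N e0; rewrite ltr_norml => /andP[_ ym].
by exists m.
Qed.

Lemma positive_gen_b_weakly_compact_monotone (R : realType)
    (E : frechetLatticeType R) :
  (forall (F : banachLatticeType R) (T : {linear E -> F}),
    (forall x : E, rle 0 x -> rle 0 (T x)) -> gen_b_weakly_compact T) ->
  forall x : nat -> E, (forall n, rle 0 (x n)) ->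
    (forall m n, (m <= n)%N -> rle (x m) (x n)) ->
    tvs_bounded (range x) -> exists l : E, x @ \oo --> l.
Proof.
move=> wc x x0 xinc xbnd; apply: cauchy_csn => q e cq e0.
have [sq _] := cq.
(* Every [f] in [I] satisfies [|f y| <= q y], so [y] becomes a bounded function on [I]. *)
pose I := {f : dual E | dual_le 0 f /\ forall y, f y <= q (rpos y)}.
have /choice[T TE] (y : E) : exists h : bounded_function R I,
    forall i, h i = sval i y.
  apply: (@bounded_function_intro _ _ _ (q y)) => -[f [f0 fq]] /=.
  exact: dual_le_norm.
have linT : linear T.
  move=> a y z; apply: bounded_function_ext => i.
  by rewrite TE -[RHS]/(a *: T y i + T z i) !TE dual_xD dual_xZ.
pose Tm := GRing.isLinear.Build _ _ _ _ _ linT.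
pose TL : {linear E -> bounded_function R I} := HB.pack T Tm.
have posT y : rle 0 y -> rle 0 (TL y).
  move=> y0; have h i : 0 <= (T y i : R).
    by rewrite TE; have [/= f0 _] := svalP i; exact: f0.
  exact: h.
have [v vlim] := bidual_monotone_limit xinc xbnd.
(* The order bound in the bidual is the pointwise limit [v] of the sequence. *)
have bx : b_order_bounded (range x).
  exists 0, v => _ [n _ <-]; split=> [f f0|]; first exact: f0.
  by have [ub _] := bidual_monotone_sup xinc vlim; apply: ub; exists n.
have Txinc m n : (m <= n)%N -> rle (T (x m)) (T (x n)).
  by move=> mn; exact: (positive_homo posT (xinc m n mn)).
have [y yT] : exists y : bounded_function R I,
    cluster ((T \o x) @ \oo : set_system (weak_space (bounded_function R I))) y.
  have /(_ ((T \o x) @ \oo)) [|y [_ yT]] := wc _ TL posT _ bx; last by exists y.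
  by exists 0%N => // k _; apply: subset_closure; exists (x k).
have Txy n : rle (T (x n)) y.
  have h i : (T (x n) i : R) <= y i.
    have [phi phiE] := @bounded_function_coordinate R I i.
    have phi0 : dual_le 0 phi by move=> f f0; rewrite phiE; exact: f0.
    by have [/(_ n) + _] := weak_cluster_below Txinc yT phi0; rewrite !phiE.
  exact: h.
pose u n := y - T (x n).
have udec m n : (m <= n)%N -> rle (u n) (u m).
  move=> mn; have h := rle_opp (Txinc m n mn); exact: (rleD (rle_refl y) h).
have u0 n : rle 0 (u n) by exact: rsub_ge0.
have e2 : 0 < e / 2 by rewrite divr_gt0.
have [N uN] : exists N, `|u N| < e / 2.
  (* Otherwise some positive [phi] is at least [e / 2] on all [u n], while [phi (T (x n))] comes
     closer than that to [phi y]. *)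
  apply: contrapT => nu; have ue n : e / 2 <= `|u n|.
    by rewrite leNgt; apply/negP => un; apply: nu; exists n.
  have [phi [phi0 phiu]] :=
    dual_below_decreasing (csn_norm (bounded_function R I)) e2 u0 udec ue.
  have [_ /(_ _ e2)[n]] := weak_cluster_below Txinc yT phi0.
  by have := phiu n; rewrite dual_xB; lra.
exists [set n | (N <= n)%N]; first by exists N.
(* A functional that norms [x n - x m] is itself an index in [I], so [q (x n - x m)] is a coordinate
   of [u m - u n]. *)
have small m n : (N <= m)%N -> (m <= n)%N -> q (x n - x m) < e.
  move=> Nm mn; have [f [f0 fq fx]] := dual_norming (x n - x m) cq.
  rewrite -(rpos_id (rsub_ge0 (xinc m n mn))) -fx dual_xB.
  pose i : I := exist _ f (conj f0 fq).
  have -> : (f (x n) : R) - f (x m) = (u m - u n) i.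
    rewrite -[RHS]/(((y i : R) - T (x m) i) - ((y i : R) - T (x n) i)) !TE /=.
    by lra.
  apply: le_lt_trans (ler_norm _) _.
  apply: le_lt_trans (sup_norm_ge (u m - u n) i) _.
  rewrite -bounded_function_normE; apply: le_lt_trans (ler_normB _ _) _.
  have uk k : (N <= k)%N -> `|u k| < e / 2.
    move=> Nk; apply: le_lt_trans uN.
    by apply: (riesz_seminorm_le (lattice_norm_seminorm _)) => //; exact: udec.
  by have := uk m Nm; have := uk n (leq_trans Nm mn); lra.
move=> m n /= Nm Nn; have [mn|/ltnW nm] := leqP n m; first exact: small.
by rewrite -(riesz_seminormN sq) opprB; exact: small.
Qed.

Theorem theorem3p8 (R : realType) (E : frechetLatticeType R) :
  [<->
    is_band bidual_le (range (@eval_bidual R E));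
    forall (X : completeNormedModType R) (T : {linear E -> X}),
      continuous T -> gen_b_weakly_compact T;
    forall (F : banachLatticeType R) (T : {linear E -> F}),
      (forall x : E, rle 0 x -> rle 0 (T x)) -> gen_b_weakly_compact T;
    forall x : nat -> E,
      (forall n, rle 0 (x n)) ->
      (forall m n, (m <= n)%N -> rle (x m) (x n)) ->
      tvs_bounded (range x) ->
      exists l : E, x @ \oo --> l;
    forall (I : Type) (le : I -> I -> Prop) (x : I -> E),
      directed le ->
      (forall i, rle 0 (x i)) ->
      (forall i j, le i j -> rle (x i) (x j)) ->
      tvs_bounded (range x) ->
      exists l : E, x @ tails le --> l].
Proof.
tfae.
(* The passage from (1) to (2) goes through sequences and nets, which provide the Levi property. *)
- move=> band X T; apply: levi_gen_b_weakly_compact.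
  by apply: monotone_seq_net => x _; exact: band_monotone_cvg band x.
- by move=> wc F T posT; apply: wc; exact: positive_continuous.
- exact: positive_gen_b_weakly_compact_monotone.
- exact: monotone_seq_net.
- exact: levi_band.
Qed.
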